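(* Work over $\mathsf{CZF}^-$, with universe $V$, and let $\mathbb{P}$ be a frame. Then every axiom of $\mathsf{CZF}^-$ is valid in the Kripke model $V^{\mathbb{P}}$. Moreover, if $V$ satisfies Subset Collection, then $V^{\mathbb{P}}$ satisfies Subset Collection; if $V$ satisfies $\mathsf{Sep}$, then $V^{\mathbb{P}}$ satisfies $\mathsf{Sep}$; and if $V$ satisfies $\mathsf{Pow}$, then $V^{\mathbb{P}}$ satisfies $\mathsf{Pow}$.
   Context: The logic is intuitionistic. $\mathsf{CZF}^-$ has axioms Extensionality, Pairing, Union, Infinity, the $\in$-Induction scheme, $\Delta_0$-Separation, and Strong Collection (if $\forall x\in a\,\exists y\,\phi(x,y)$ then there is a set $b$ with $\forall x\in a\,\exists y\in b\,\phi(x,y)$ and $\forall y\in b\,\exists x\in a\,\phi(x,y)$). Subset Collection: for all sets $a,b$ there is a set $c$ such that for all $u$, if $\forall x\in a\,\exists y\in b\,\phi(x,y,u)$ then there is $d\in c$ with $\forall x\in a\,\exists y\in d\,\phi(x,y,u)$ and $\forall y\in d\,\exists x\in a\,\phi(x,y,u)$. $\mathsf{Sep}$ is the full Separation scheme, $\mathsf{Pow}$ the Power Set axiom. A frame is a partially ordered set $(\mathbb{P},\le)$ with a least element $\bot$; $\uparrow p=\{q\in\mathbb{P}\mid q\ge p\}$. Kripke sets: for an ordinal $\alpha$ and $p\in\mathbb{P}$, the class $V^{\mathbb{P}}_\alpha(p)$ is defined inductively as the class of all functions $x$ with domain $\uparrow p$ such that (i) $x(q)\subseteq\bigcup_{\beta\in\alpha}V^{\mathbb{P}}_\beta(q)$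 for all $q\ge p$, and (ii) (monotonicity) $\tau_{qr}''[x(q)]\subseteq x(r)$ for all $p\le q\le r$, where the transition function is $\tau_{qr}(y)=y\upharpoonright(\uparrow r)$ for $y$ with domain $\uparrow q$. (This hierarchy of classes exists over $\mathsf{CZF}^-$ by the Class Inductive Definition theorem.) Let $V^{\mathbb{P}}(p)=\bigcup_{\alpha\in\mathrm{Ord}}V^{\mathbb{P}}_\alpha(p)$ and $V^{\mathbb{P}}=\bigcup_{p}V^{\mathbb{P}}(p)$. Forcing: for parameters in $V^{\mathbb{P}}(p)$, $p\Vdash x\in y$ iff $x\in y(p)$; $p\Vdash x=y$ iff $x(q)=y(q)$ for all $q\ge p$; $p\Vdash\phi\land\psi$ iff $p\Vdash\phi$ and $p\Vdash\psi$; $p\Vdash\phi\lor\psi$ iff $p\Vdash\phi$ or $p\Vdash\psi$; $p\Vdash\phi\to\psi$ iff for each $q\ge p$, $q\Vdash\phi$ implies $q\Vdash\psi$; $p\Vdash\forall x\,\phi(x)$ iff $q\Vdash\phi(x)$ for each $q\ge p$ and $x\in V^{\mathbb{P}}(q)$; $p\Vdash\exists x\,\phi(x)$ iff $p\Vdash\phi(x)$ for some $x\in V^{\mathbb{P}}(p)$; no $p$ forces falsum, and $\neg\phi$ is $\phi\to$ falsum. A parameter $a\in V^{\mathbb{P}}(r)$ with $r\le q$ is read at node $q$ as $\tau_{rq}(a)$. A sentence is valid in (satisfied by) $V^{\mathbb{P}}$ if $\bot$ forces it. *)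

(* Defs.v *)
(** Only Rocq's core logic is used.  [Prop] is intuitionistic, and the universe
    is an arbitrary [Prop]-valued structure [(V, ∈)], so "V satisfies T" is the
    intuitionistic Tarski satisfaction of the sentences of [T] in [V]. *)

Set Implicit Arguments.
Unset Strict Implicit.

(** [formula n] is the type of formulas whose free variables are among the [n]
    de Bruijn indices [var n]; a sentence is a [formula 0]. *)

Fixpoint var (n : nat) : Type :=
  match n with
  | O => Empty_set
  | S m => option (var m)
  end.

Inductive formula : nat -> Type :=
| Mem  : forall n, var n -> var n -> formula n
| Eq   : forall n, var n -> var n -> formula n
| Bot  : forall n, formula n
| And  : forall n, formula n -> formula n -> formula n
| Or   : forall n, formula n -> formula n -> formula n
| Imp  : forall n, formula n -> formula n -> formula n
| All  : forall n, formula (S n) -> formula n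
| Ex   : forall n, formula (S n) -> formula n.

Arguments Bot {n}.

Definition sentence := formula 0.
Definition theory := sentence -> Prop.

Definition v0 {n} : var (S n) := None.
Definition v1 {n} : var (S (S n)) := Some v0.
Definition v2 {n} : var (S (S (S n))) := Some v1.
Definition v3 {n} : var (S (S (S (S n)))) := Some v2.

Definition scons {X : Type} {n} (x : X) (e : var n -> X) : var (S n) -> X :=
  fun i => match i with None => x | Some j => e j end.

Definition snil {X : Type} : var 0 -> X :=
  fun i => match i with end.

Notation "x .: e" := (scons x e) (at level 55, right associativity).

Definition wk1 {n} (i : var n) : var (S n) := Some i.
Definition wk2 {n} (i : var n) : var (S (S n)) := wk1 (wk1 i).
Definition wk3 {n} (i : var n) : var (S (S (S n))) := wk1 (wk2 i).
Definition wk4 {n} (i : var n) : var (S (S (S (S n)))) := wk1 (wk3 i).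

Fixpoint ren {m} (φ : formula m) : forall n, (var m -> var n) -> formula n :=
  match φ in formula m return forall n, (var m -> var n) -> formula n with
  | Mem i j => fun _ f => Mem (f i) (f j)
  | Eq i j  => fun _ f => Eq (f i) (f j)
  | Bot     => fun _ _ => Bot
  | And ψ χ => fun _ f => And (ren ψ f) (ren χ f)
  | Or ψ χ  => fun _ f => Or (ren ψ f) (ren χ f)
  | Imp ψ χ => fun _ f => Imp (ren ψ f) (ren χ f)
  | All ψ   => fun _ f => All (ren ψ (v0 .: (fun i => wk1 (f i))))
  | Ex ψ    => fun _ f => Ex (ren ψ (v0 .: (fun i => wk1 (f i))))
  end.

Definition Iff {n} (φ ψ : formula n) : formula n := And (Imp φ ψ) (Imp ψ φ).

(** Bounded quantifiers: [BAll a φ] is "∀ v0 ∈ a, φ", where [a] lives outside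
    the scope of the quantifier. *)
Definition BAll {n} (a : var n) (φ : formula (S n)) : formula n :=
  All (Imp (Mem v0 (wk1 a)) φ).
Definition BEx {n} (a : var n) (φ : formula (S n)) : formula n :=
  Ex (And (Mem v0 (wk1 a)) φ).

Inductive Delta0 : forall n, formula n -> Prop :=
| D0_Mem  : forall n (i j : var n), Delta0 (Mem i j)
| D0_Eq   : forall n (i j : var n), Delta0 (Eq i j)
| D0_Bot  : forall n, Delta0 (@Bot n)
| D0_And  : forall n (φ ψ : formula n), Delta0 φ -> Delta0 ψ -> Delta0 (And φ ψ)
| D0_Or   : forall n (φ ψ : formula n), Delta0 φ -> Delta0 ψ -> Delta0 (Or φ ψ)
| D0_Imp  : forall n (φ ψ : formula n), Delta0 φ -> Delta0 ψ -> Delta0 (Imp φ ψ)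
| D0_BAll : forall n (a : var n) (φ : formula (S n)), Delta0 φ -> Delta0 (BAll a φ)
| D0_BEx  : forall n (a : var n) (φ : formula (S n)), Delta0 φ -> Delta0 (BEx a φ).

Fixpoint closure (n : nat) : formula n -> sentence :=
  match n return formula n -> sentence with
  | O => fun φ => φ
  | S m => fun φ => closure (All φ)
  end.

(** ∀x ∀y, (∀z, z ∈ x ↔ z ∈ y) → x = y *)
Definition Extensionality : sentence :=
  All (All (Imp (All (Iff (Mem v0 v2) (Mem v0 v1))) (Eq v1 v0))).

(** ∀x ∀y ∃c ∀z, z ∈ c ↔ z = x ∨ z = y *)
Definition Pairing : sentence :=
  All (All (Ex (All (Iff (Mem v0 v1) (Or (Eq v0 v3) (Eq v0 v2)))))).

(** ∀x ∃u ∀z, z ∈ u ↔ ∃y ∈ x, z ∈ y *)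
Definition Union : sentence :=
  All (Ex (All (Iff (Mem v0 v1) (BEx v2 (Mem v1 v0))))).

(** ∃x, (∃e ∈ x, ∀z ∈ e, ⊥) ∧ ∀y ∈ x, ∃s ∈ x, ∀z, z ∈ s ↔ z ∈ y ∨ z = y *)
Definition Infinity : sentence :=
  Ex (And (BEx v0 (BAll v0 Bot))
          (BAll v0 (BEx v1 (All (Iff (Mem v0 v1) (Or (Mem v0 v2) (Eq v0 v2))))))).

(** In the schemes, the variables of [φ] beyond the displayed ones are
    parameters, and the bound set variables do not occur in [φ]. *)

(** (∀x, (∀y ∈ x, φ(y)) → φ(x)) → ∀x, φ(x);  in φ: v0 = element *)
Definition Induction {n} (φ : formula (S n)) : formula n :=
  Imp (All (Imp (BAll v0 (ren φ (v0 .: wk2))) φ)) (All φ).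

(** ∀a ∃b ∀x, x ∈ b ↔ x ∈ a ∧ φ(x);  in φ: v0 = x *)
Definition Separation {n} (φ : formula (S n)) : formula n :=
  All (Ex (All (Iff (Mem v0 v1) (And (Mem v0 v2) (ren φ (v0 .: wk3)))))).

(** ∀a, (∀x ∈ a, ∃y, φ(x,y)) →
    ∃b, (∀x ∈ a, ∃y ∈ b, φ(x,y)) ∧ (∀y ∈ b, ∃x ∈ a, φ(x,y));
    in φ: v0 = y, v1 = x *)
Definition StrongCollection {n} (φ : formula (S (S n))) : formula n :=
  All (Imp (BAll v0 (Ex (ren φ (v0 .: v1 .: wk3))))
           (Ex (And (BAll v1 (BEx v1 (ren φ (v0 .: v1 .: wk4))))
                    (BAll v0 (BEx v2 (ren φ (v1 .: v0 .: wk4))))))).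

(** ∀a ∀b ∃c ∀u, (∀x ∈ a, ∃y ∈ b, φ(x,y,u)) →
    ∃d ∈ c, (∀x ∈ a, ∃y ∈ d, φ(x,y,u)) ∧ (∀y ∈ d, ∃x ∈ a, φ(x,y,u));
    in φ: v0 = y, v1 = x, v2 = u *)
Definition SubsetCollection {n} (φ : formula (S (S (S n)))) : formula n :=
  All (All (Ex (All
    (Imp (BAll v3 (BEx v3 (ren φ (v0 .: v1 .: v2 .: (fun i => wk2 (wk4 i))))))
         (BEx v1
           (And (BAll (wk1 v3)
                  (BEx v1 (ren φ (v0 .: v1 .: v3 .: (fun i => wk3 (wk4 i))))))
                (BAll v0
                  (BEx (wk2 v3) (ren φ (v1 .: v0 .: v3 .: (fun i => wk3 (wk4 i)))))))))))).

(** ∀a ∃b ∀x, x ∈ b ↔ ∀z ∈ x, z ∈ a *)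
Definition PowerSet : sentence :=
  All (Ex (All (Iff (Mem v0 v1) (BAll v0 (Mem v0 v3))))).

Inductive CZFminus : theory :=
| CZF_ext  : CZFminus Extensionality
| CZF_pair : CZFminus Pairing
| CZF_un   : CZFminus Union
| CZF_inf  : CZFminus Infinity
| CZF_ind  : forall n (φ : formula (S n)), CZFminus (closure (Induction φ))
| CZF_sep  : forall n (φ : formula (S n)),
    Delta0 φ -> CZFminus (closure (Separation φ))
| CZF_coll : forall n (φ : formula (S (S n))),
    CZFminus (closure (StrongCollection φ)).

Inductive SubColl : theory :=
| SubColl_intro : forall n (φ : formula (S (S (S n)))),
    SubColl (closure (SubsetCollection φ)).

Inductive Sep : theory :=
| Sep_intro : forall n (φ : formula (S n)), Sep (closure (Separation φ)).

Inductive Pow : theory :=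
| Pow_intro : Pow PowerSet.

Record structure := {
  carrier :> Type;
  mem : carrier -> carrier -> Prop
}.

Arguments mem {s} _ _.
Notation "x ∈ y" := (mem x y) (at level 70, no associativity).

Fixpoint sat {V : structure} {n} (φ : formula n) : (var n -> V) -> Prop :=
  match φ in formula n return (var n -> V) -> Prop with
  | Mem i j => fun e => e i ∈ e j
  | Eq i j  => fun e => e i = e j
  | Bot     => fun _ => False
  | And ψ χ => fun e => sat ψ e /\ sat χ e
  | Or ψ χ  => fun e => sat ψ e \/ sat χ e
  | Imp ψ χ => fun e => sat ψ e -> sat χ e
  | All ψ   => fun e => forall x : V, sat ψ (x .: e)
  | Ex ψ    => fun e => exists x : V, sat ψ (x .: e)
  end.

Definition satisfies (V : structure) (T : theory) : Prop :=
  forall φ : sentence, T φ -> sat φ (@snil V).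

Section Vocabulary.

Context {V : structure}.

Definition is_upair (a b c : V) : Prop :=
  forall z : V, z ∈ c <-> z = a \/ z = b.

(** Kuratowski pairs: [c] is {{a}, {a, b}}. *)
Definition is_opair (a b c : V) : Prop :=
  forall z : V, z ∈ c <-> is_upair a a z \/ is_upair a b z.

(** ⟨a, b⟩ ∈ f *)
Definition pair_in (a b f : V) : Prop :=
  exists c : V, is_opair a b c /\ c ∈ f.

Definition transitive (a : V) : Prop :=
  forall x y : V, x ∈ a -> y ∈ x -> y ∈ a.

Definition ordinal (a : V) : Prop :=
  transitive a /\ forall x : V, x ∈ a -> transitive x.

(** y ∈ f(q), for a set function [f]. *)
Definition in_app (y f q : V) : Prop :=
  exists s : V, pair_in q s f /\ y ∈ s.

(** f(q) = g(q), for set functions [f] and [g] defined at [q]. *)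
Definition eq_app (f g q : V) : Prop :=
  exists s : V, pair_in q s f /\ pair_in q s g.

(** Classes are first-order definable with parameters; here ternary ones. *)
Definition is_class3 (H : V -> V -> V -> Prop) : Prop :=
  exists (n : nat) (φ : formula (S (S (S n)))) (e : var n -> V),
    forall a b c : V, H a b c <-> sat φ (a .: b .: c .: e).

End Vocabulary.

(** The poset and its order are sets of [V]; the order is a set of pairs. *)
Record frame (V : structure) := {
  nodes : V;
  order : V;
  bot : V;
  order_rel : forall z : V, z ∈ order ->
    exists p q : V, p ∈ nodes /\ q ∈ nodes /\ is_opair p q z;
  order_refl : forall p : V, p ∈ nodes -> pair_in p p order;
  order_antisym : forall p q : V, pair_in p q order -> pair_in q p order -> p = q;
  order_trans : forall p q r : V,
    pair_in p q order -> pair_in q r order -> pair_in p r order;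
  bot_node : bot ∈ nodes;
  bot_least : forall p : V, p ∈ nodes -> pair_in bot p order
}.

Section Kripke.

Context {V : structure} (P : frame V).

Definition le (p q : V) : Prop := pair_in p q (order P).

(** [x] is a function with domain ↑p. *)
Definition function_on_up (p x : V) : Prop :=
  (forall z : V, z ∈ x -> exists q s : V, le p q /\ is_opair q s z) /\
  (forall q : V, le p q -> exists! s : V, pair_in q s x).

(** [y'] is y ↾ ↑r; this is the transition function τ_qr applied to [y], for [y]
    with domain ↑q and q ≤ r. *)
Definition restr (y r y' : V) : Prop :=
  forall z : V, z ∈ y' <-> z ∈ y /\ exists t s : V, le r t /\ is_opair t s z.

(** The clause defining V_α(p) from the classes V_β(q), β ∈ α. *)
Definition kripke_step (H : V -> V -> V -> Prop) (α p x : V) : Prop :=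
  p ∈ nodes P /\
  function_on_up p x /\
  (forall q y : V, le p q -> in_app y x q -> exists β : V, β ∈ α /\ H β q y) /\
  (forall q r y y' : V, le p q -> le q r -> in_app y x q -> restr y r y' ->
     in_app y' x r).

(** x ∈ V_α(p): the least class closed under [kripke_step].  By ∈-induction on
    α the recursion has only one solution among classes, so this is the class
    that it defines.  A Rocq [Inductive] predicate would instead keep only those
    sets that are well-founded outside [V], which is too few when ∈ is not
    externally well-founded; hence the restriction to classes of [V]. *)
Definition kripke_set_at (α p x : V) : Prop :=
  forall H : V -> V -> V -> Prop,
    is_class3 H ->
    (forall β q y : V, kripke_step H β q y -> H β q y) ->
    H α p x.

(** x ∈ V(p) *)
Definition kripke_set (p x : V) : Prop :=
  exists α : V, ordinal α /\ kripke_set_at α p x.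

(** [e'] is the assignment [e] read at the node [q]. *)
Definition restr_env {n} (e : var n -> V) (q : V) (e' : var n -> V) : Prop :=
  forall i : var n, restr (e i) q (e' i).

Fixpoint forces {n} (φ : formula n) : V -> (var n -> V) -> Prop :=
  match φ in formula n return V -> (var n -> V) -> Prop with
  | Mem i j => fun p e => in_app (e i) (e j) p
  | Eq i j  => fun p e => forall q : V, le p q -> eq_app (e i) (e j) q
  | Bot     => fun _ _ => False
  | And ψ χ => fun p e => forces ψ p e /\ forces χ p e
  | Or ψ χ  => fun p e => forces ψ p e \/ forces χ p e
  | Imp ψ χ => fun p e => forall (q : V) e', le p q -> restr_env e q e' ->
                 forces ψ q e' -> forces χ q e'
  | All ψ   => fun p e => forall (q : V) e', le p q -> restr_env e q e' ->
                 forall x : V, kripke_set q x -> forces ψ q (x .: e')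
  | Ex ψ    => fun p e => exists x : V, kripke_set p x /\ forces ψ p (x .: e)
  end.

Definition kripke_satisfies (T : theory) : Prop :=
  forall φ : sentence, T φ -> forces φ (bot P) snil.

End Kripke.

(* Main.v *)
From Stdlib Require Import Setoid.
Require Import Defs.

(** To force an axiom at a node [p] one has to name the set that it asks for, and
    a name is nothing but a function sending each [q] above [p] to a set of names
    at [q], monotonically in [q].  So the Kripke universe has a comprehension
    principle ([D_comprehension]): any definable family of classes [N q] of names
    at [q] that is stable under restriction has a name, as soon as each [N q] is a
    set of [V].  Every axiom then comes down to the corresponding axiom of [V]:

    - For Pairing, Union and Separation the family can be written down, and the
      only question is whether its members are sets.  For Separation this asks for
      the subset [{y ∈ a(q) | q ⊩ φ(y)}]; call a proposition [Q] small when every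
      [{a | Q}] is a set.  Small propositions are closed under the connectives and
      under quantifiers bounded by a set, and forcing a Δ0 formula only quantifies
      over nodes and over members of names, so it is small
      ([small_force_Delta0]).  Under full Separation in [V] everything definable
      is small ([small_of_Sep]).

    - Strong Collection, Subset Collection and Power Set are applied in [V] to sets
      of pairs (node, name at that node).  The sets of pairs they return need
      not be monotone, but closing one under restriction gives a name ([D_generated],
      [name_of_pairs]), and since forcing is monotone the closure has the members
      one wants.

    - Induction holds because the levels of the universe are indexed by ordinals
      ([D_ind]).  For Infinity one names the numerals by recursion along the
      infinite set of [V].

    [V] is an arbitrary structure, so its schemes apply only to predicates given by
    a formula with parameters; [definable] expresses this, and the tactic
    [prove_definable] proves it by recursion on the shape of a predicate.  The one
    predicate that is not given by a formula is [kripke_set_at], an impredicative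
    intersection of classes.  Its defining step refers only to set-many earlier
    instances, so the union of all sets that justify themselves by the step is a
    class and a fixed point; as the step descends along [α], ∈-induction shows
    that this greatest fixed point is also the least one ([kripke_set_at_gfp]).

    Finally, [forces] replaces the whole environment by its restriction whenever it
    moves to a higher node.  The relation [force] leaves the environment alone and
    restricts only in the atomic clauses.  It agrees with [forces]
    ([forces_iff_force]) but is visibly definable, commutes with renaming of
    variables, and makes the model a Kripke structure with increasing domains
    [denotes p], in which the axioms are verified. *)

(** * Formulas and definable predicates *)

Lemma sat_ext {V : structure} {n} (φ : formula n) :
  forall e e' : var n -> V, (forall i, e i = e' i) -> sat φ e <-> sat φ e'.
Proof.
  induction φ; intros e e' H; simpl.
  - rewrite !H; tauto.
  - rewrite !H; tauto.
  - tauto.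
  - rewrite (IHφ1 _ _ H), (IHφ2 _ _ H); tauto.
  - rewrite (IHφ1 _ _ H), (IHφ2 _ _ H); tauto.
  - rewrite (IHφ1 _ _ H), (IHφ2 _ _ H); tauto.
  - split; intros K x; (eapply IHφ; [|apply (K x)]); intros [i|]; simpl; auto.
  - split; intros [x K]; exists x; (eapply IHφ; [|apply K]); intros [i|]; simpl; auto.
Qed.

Lemma sat_ren {V : structure} {m} (φ : formula m) :
  forall n (f : var m -> var n) (e : var n -> V),
  sat (ren φ f) e <-> sat φ (fun i => e (f i)).
Proof.
  induction φ; intros k f e; simpl.
  - tauto.
  - tauto.
  - tauto.
  - rewrite IHφ1, IHφ2; tauto.
  - rewrite IHφ1, IHφ2; tauto.
  - rewrite IHφ1, IHφ2; tauto.
  - split; intros K x; specialize (K x); rewrite IHφ in *;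
    (eapply sat_ext; [|apply K]); intros [i|]; reflexivity.
  - split; intros [x K]; exists x; rewrite IHφ in *;
    (eapply sat_ext; [|apply K]); intros [i|]; reflexivity.
Qed.

Lemma sat_closure {V : structure} {n} (φ : formula n) :
  sat (closure φ) (@snil V) -> forall e : var n -> V, sat φ e.
Proof.
  induction n; simpl; intros H e.
  - eapply sat_ext; [|exact H]; intros [].
  - pose proof (IHn _ H (fun i => e (Some i)) (e None)) as K.
    eapply sat_ext; [|exact K]; intros [i|]; reflexivity.
Qed.

Fixpoint env_app {X : Type} {k n} : (var k -> X) -> (var n -> X) -> var (k + n) -> X :=
  match k with
  | O => fun _ e => e
  | S k' => fun g e => g None .: env_app (fun i => g (Some i)) e
  end.

Fixpoint var_l {k n} : var k -> var (k + n) :=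
  match k with
  | O => fun i => match i with end
  | S k' => fun i => match i with None => None | Some j => Some (var_l j) end
  end.

Fixpoint var_r {k n} : var n -> var (k + n) :=
  match k with
  | O => fun i => i
  | S k' => fun i => Some (var_r i)
  end.

Lemma env_app_var_l {X k n} (g : var k -> X) (e : var n -> X) i : env_app g e (var_l i) = g i.
Proof.
  induction k; [destruct i|]; destruct i as [i|]; simpl; auto.
  rewrite IHk; reflexivity.
Qed.

Lemma env_app_var_r {X k n} (g : var k -> X) (e : var n -> X) i : env_app g e (var_r i) = e i.
Proof. induction k; simpl; auto. Qed.

Lemma env_app_map {X Y k n} (h : X -> Y) (g : var k -> X) (e : var n -> X) i :
  h (env_app g e i) = env_app (fun j => h (g j)) (fun j => h (e j)) i.
Proof.
  induction k; simpl; auto. destruct i as [i|]; simpl; auto.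
Qed.

Lemma env_app_ext {X k n} (g g' : var k -> X) (e e' : var n -> X) i :
  (forall j, g j = g' j) -> (forall j, e j = e' j) -> env_app g e i = env_app g' e' i.
Proof.
  intros Hg He; induction k; simpl; auto. destruct i as [i|]; simpl; auto.
Qed.

Section Definability.

Context {V : structure}.

(** The [k] arguments come first and the parameters last, which is the position
    where the axiom schemes keep their parameters. *)
Definition definable {k} (R : (var k -> V) -> Prop) : Prop :=
  exists n (φ : formula (k + n)) (e : var n -> V),
    forall g, R g <-> sat φ (env_app g e).

(** The values that a formula can mention: an argument or a parameter. *)
Definition term {k} (a : (var k -> V) -> V) : Prop :=
  (exists i, forall g, a g = g i) \/ (exists c, forall g, a g = c).

Definition tail {k} (g : var (S k) -> V) : var k -> V := fun i => g (Some i).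

(** Under [j] binders the arguments of a predicate are reached through [j]
    applications of [tail]; these are the only such maps that occur. *)
Definition renaming {k m} (u : (var k -> V) -> var m -> V) : Prop :=
  exists f : var m -> var k, forall g i, u g i = g (f i).

Lemma renaming_id {k} : renaming (fun g : var k -> V => g).
Proof. exists (fun i => i); auto. Qed.

Lemma renaming_tail {k m} (u : (var k -> V) -> var (S m) -> V) :
  renaming u -> renaming (fun g => tail (u g)).
Proof. intros [f H]; exists (fun i => f (Some i)); intros; apply H. Qed.

Lemma term_const {k} c : term (fun _ : var k -> V => c).
Proof. right; exists c; auto. Qed.

Lemma term_comp {k m} (a : (var m -> V) -> V) (u : (var k -> V) -> var m -> V) :
  term a -> renaming u -> term (fun g => a (u g)).
Proof.
  intros [[i H]|[c H]] [f Hf].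
  - left; exists (f i); intros; rewrite H; apply Hf.
  - right; exists c; intros; apply H.
Qed.

Lemma term_at {k m} (E : (var m -> V) -> var k -> V) {l} (u : (var l -> V) -> var m -> V) i :
  (forall i, term (fun g => E g i)) -> renaming u -> term (fun g => E (u g) i).
Proof. intros H Hu; apply (term_comp (fun g => E g i)); auto. Qed.

Lemma term_scons {k m} (a : (var k -> V) -> V) (E : (var k -> V) -> var m -> V) :
  term a -> (forall i, term (fun g => E g i)) -> forall i, term (fun g => (a g .: E g) i).
Proof. intros Ha HE [i|]; simpl; auto. Qed.

Lemma term_env_app {k} (a : (var k -> V) -> V) : term a ->
  exists n (e : var n -> V) (i : var (k + n)), forall g, a g = env_app g e i.
Proof.
  intros [[i H]|[c H]].
  - exists 0, snil, (var_l i); intros; rewrite H, env_app_var_l; auto.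
  - exists 1, (fun _ => c), (var_r (None : var 1)); intros; rewrite H, env_app_var_r; auto.
Qed.

Lemma definable_iff {k} (R R' : (var k -> V) -> Prop) :
  (forall g, R' g <-> R g) -> definable R -> definable R'.
Proof.
  intros H (n & φ & e & K); exists n, φ, e; intros; rewrite H; apply K.
Qed.

Lemma env_app_align_l {k n1 n2} (e1 : var n1 -> V) (e2 : var n2 -> V) (g : var k -> V) i :
  env_app g (env_app e1 e2) (env_app var_l (fun j => var_r (var_l j)) i) = env_app g e1 i.
Proof.
  rewrite (env_app_map (env_app g (env_app e1 e2))); apply env_app_ext; intros;
  rewrite ?env_app_var_l, ?env_app_var_r, ?env_app_var_l; auto.
Qed.

Lemma env_app_align_r {k n1 n2} (e1 : var n1 -> V) (e2 : var n2 -> V) (g : var k -> V) i :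
  env_app g (env_app e1 e2) (env_app var_l (fun j => var_r (var_r j)) i) = env_app g e2 i.
Proof.
  rewrite (env_app_map (env_app g (env_app e1 e2))); apply env_app_ext; intros;
  rewrite ?env_app_var_l, ?env_app_var_r, ?env_app_var_r; auto.
Qed.

(** Two predicates come with separate parameters; a connective needs one formula in
    the concatenation of both. *)
Lemma definable_align {k} (R1 R2 : (var k -> V) -> Prop) : definable R1 -> definable R2 ->
  exists n (φ1 φ2 : formula (k + n)) (e : var n -> V),
    (forall g, R1 g <-> sat φ1 (env_app g e)) /\ (forall g, R2 g <-> sat φ2 (env_app g e)).
Proof.
  intros (n1 & φ1 & e1 & H1) (n2 & φ2 & e2 & H2).
  exists (n1 + n2), (ren φ1 (env_app var_l (fun j => var_r (var_l j)))),
    (ren φ2 (env_app var_l (fun j => var_r (var_r j)))), (env_app e1 e2).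
  split; intros g; rewrite sat_ren; [rewrite H1 | rewrite H2]; apply sat_ext;
  intros; symmetry; [apply env_app_align_l | apply env_app_align_r].
Qed.

Lemma definable_and {k} (A B : (var k -> V) -> Prop) :
  definable A -> definable B -> definable (fun g => A g /\ B g).
Proof.
  intros HA HB; destruct (definable_align _ _ HA HB) as (n & φ & ψ & e & H1 & H2).
  exists n, (And φ ψ), e; intros g; simpl; rewrite H1, H2; tauto.
Qed.

Lemma definable_or {k} (A B : (var k -> V) -> Prop) :
  definable A -> definable B -> definable (fun g => A g \/ B g).
Proof.
  intros HA HB; destruct (definable_align _ _ HA HB) as (n & φ & ψ & e & H1 & H2).
  exists n, (Or φ ψ), e; intros g; simpl; rewrite H1, H2; tauto.
Qed.

Lemma definable_imp {k} (A B : (var k -> V) -> Prop) :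
  definable A -> definable B -> definable (fun g => A g -> B g).
Proof.
  intros HA HB; destruct (definable_align _ _ HA HB) as (n & φ & ψ & e & H1 & H2).
  exists n, (Imp φ ψ), e; intros g; simpl; rewrite H1, H2; tauto.
Qed.

Lemma definable_False {k} : definable (fun _ : var k -> V => False).
Proof. exists 0, Bot, snil; intros; simpl; tauto. Qed.

Lemma definable_all {k} (B : (var k -> V) -> V -> Prop) :
  definable (fun g => B (tail g) (g None)) -> definable (fun g => forall x, B g x).
Proof.
  intros (n & φ & e & H); exists n, (All φ), e; intros g; simpl.
  split; intros K x.
  - apply (H (x .: g)), K.
  - apply (H (x .: g)), K.
Qed.

Lemma definable_ex {k} (B : (var k -> V) -> V -> Prop) :
  definable (fun g => B (tail g) (g None)) -> definable (fun g => exists x, B g x).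
Proof.
  intros (n & φ & e & H); exists n, (Ex φ), e; intros g; simpl.
  split; intros [x K]; exists x; apply (H (x .: g)), K.
Qed.

Lemma term_align {k} (a b : (var k -> V) -> V) : term a -> term b ->
  exists n (i j : var (k + n)) (e : var n -> V),
    (forall g, a g = env_app g e i) /\ (forall g, b g = env_app g e j).
Proof.
  intros Ha Hb; destruct (term_env_app _ Ha) as (n1 & e1 & i1 & H1).
  destruct (term_env_app _ Hb) as (n2 & e2 & i2 & H2).
  exists (n1 + n2), (env_app var_l (fun j => var_r (var_l j)) i1),
    (env_app var_l (fun j => var_r (var_r j)) i2), (env_app e1 e2).
  split; intros g; rewrite ?env_app_align_l, ?env_app_align_r; auto.
Qed.

Lemma definable_mem {k} (a b : (var k -> V) -> V) :
  term a -> term b -> definable (fun g => a g ∈ b g).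
Proof.
  intros Ha Hb; destruct (term_align _ _ Ha Hb) as (n & i & j & e & H1 & H2).
  exists n, (Mem i j), e; intros g; simpl; rewrite H1, H2; tauto.
Qed.

Lemma definable_eq {k} (a b : (var k -> V) -> V) :
  term a -> term b -> definable (fun g => a g = b g).
Proof.
  intros Ha Hb; destruct (term_align _ _ Ha Hb) as (n & i & j & e & H1 & H2).
  exists n, (Eq i j), e; intros g; simpl; rewrite H1, H2; tauto.
Qed.

(** Quantifying over all terms builds substitution into the notion, so that a
    hypothesis of this form applies at any depth of binders. *)
Definition definable1 (Q : V -> Prop) : Prop :=
  forall k (a : (var k -> V) -> V), term a -> definable (fun g => Q (a g)).

Definition definable2 (Q : V -> V -> Prop) : Prop :=
  forall k (a b : (var k -> V) -> V), term a -> term b -> definable (fun g => Q (a g) (b g)).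

Definition definable3 (Q : V -> V -> V -> Prop) : Prop :=
  forall k (a b c : (var k -> V) -> V), term a -> term b -> term c ->
    definable (fun g => Q (a g) (b g) (c g)).

Definition definable4 (Q : V -> V -> V -> V -> Prop) : Prop :=
  forall k (a b c d : (var k -> V) -> V), term a -> term b -> term c -> term d ->
    definable (fun g => Q (a g) (b g) (c g) (d g)).

Lemma definable1_formula Q : definable1 Q ->
  exists n (φ : formula (S n)) (e : var n -> V), forall x, Q x <-> sat φ (x .: e).
Proof.
  intros H; destruct (H 1 (fun g => g None)) as (n & φ & e & K).
  - left; exists None; auto.
  - exists n, φ, e; intros x; apply (K (fun _ => x)).
Qed.

Lemma definable2_formula Q : definable2 Q ->
  exists n (φ : formula (S (S n))) (e : var n -> V),
    forall x y, Q x y <-> sat φ (x .: y .: e).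
Proof.
  intros H; destruct (H 2 (fun g => g None) (fun g => g (Some None)))
    as (n & φ & e & K).
  - left; exists None; auto.
  - left; exists (Some None); auto.
  - exists n, φ, e; intros x y; apply (K (x .: y .: snil)).
Qed.

Lemma definable3_formula Q : definable3 Q ->
  exists n (φ : formula (S (S (S n)))) (e : var n -> V),
    forall x y z, Q x y z <-> sat φ (x .: y .: z .: e).
Proof.
  intros H; destruct (H 3 (fun g => g None) (fun g => g (Some None))
    (fun g => g (Some (Some None)))) as (n & φ & e & K).
  - left; exists None; auto.
  - left; exists (Some None); auto.
  - left; exists (Some (Some None)); auto.
  - exists n, φ, e; intros x y z; apply (K (x .: y .: z .: snil)).
Qed.

End Definability.

Section Sets.

Context {V : structure}.

Definition is_set (A : V -> Prop) : Prop := exists s : V, forall y, y ∈ s <-> A y.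

(** The class [{a | Q}] is a truth value: [Q] is small when its truth value can be
    formed as a set.  These are the propositions by which a set can be separated
    without full Separation ([is_set_sep]). *)
Definition small (Q : Prop) : Prop := forall a, is_set (fun z => z = a /\ Q).

(** Triples are coded as [⟨⟨a, b⟩, c⟩], so that a set can stand for a ternary
    relation. *)
Definition is_otriple (a b c d : V) : Prop :=
  exists e, is_opair a b e /\ is_opair e c d.

Definition otriple_in (G a b c : V) : Prop := exists d, is_otriple a b c d /\ d ∈ G.

End Sets.

Ltac renaming_solve :=
  repeat lazymatch goal with
  | |- renaming (fun g => g) => apply renaming_id
  | |- renaming (fun g => tail (@?u g)) => apply (renaming_tail u)
  end.

Ltac term_solve :=
  lazymatch goal with
  | |- term (fun _ => ?c) => apply term_const
  | |- term (fun g => g ?i) => left; exists i; intro; reflexivity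
  | |- term (fun g => (@?a g .: @?E g) ?i) =>
      revert i; apply (term_scons a E); [term_solve | intro; cbv beta; term_solve]
  | |- term (fun g => tail _ _) => unfold tail; left; eexists; intro; reflexivity
  | |- term (fun g => ?E (@?u g) ?i) =>
      match goal with
      | H : forall j, term (fun g => E g j) |- _ => apply (term_at E u i H); renaming_solve
      end
  | |- term (fun g => ?a (@?u g)) => apply (term_comp a u); [assumption | renaming_solve]
  end.

Ltac definable_unfold :=
  progress (cbv beta delta [is_set is_otriple otriple_in in_app pair_in eq_app is_opair
    is_upair ordinal transitive iff unique not le restr function_on_up kripke_step]).

(** Each named notion below is unfolded down to formulas in [∈] and [=]; predicates
    assumed definable in the context are left folded. *)
Ltac prove_definable :=
  cbv beta;
  lazymatch goal with
  | |- definable (fun g => @?A g /\ @?B g) => apply (definable_and A B); prove_definable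
  | |- definable (fun g => @?A g \/ @?B g) => apply (definable_or A B); prove_definable
  | |- definable (fun g => @?A g -> @?B g) => apply (definable_imp A B); prove_definable
  | |- definable (fun g => False) => apply definable_False
  | |- definable (fun g => forall x, @?B g x) => apply (definable_all B); prove_definable
  | |- definable (fun g => exists x, @?B g x) => apply (definable_ex B); prove_definable
  | |- definable (fun g => @?a g ∈ @?b g) => apply (definable_mem a b); term_solve
  | |- definable (fun g => @?a g = @?b g) => apply (definable_eq a b); term_solve
  | H : definable1 ?Q |- definable (fun g => ?Q (@?a g)) => apply (H _ a); term_solve
  | H : definable2 ?Q |- definable (fun g => ?Q (@?a g) (@?b g)) => apply (H _ a b); term_solve
  | H : definable3 ?Q |- definable (fun g => ?Q (@?a g) (@?b g) (@?c g)) =>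
      apply (H _ a b c); term_solve
  | H : definable4 ?Q |- definable (fun g => ?Q (@?a g) (@?b g) (@?c g) (@?d g)) =>
      apply (H _ a b c d); term_solve
  | |- definable1 _ => intros ? ? ?; prove_definable
  | |- definable2 _ => intros ? ? ? ? ?; prove_definable
  | |- definable3 _ => intros ? ? ? ? ? ? ?; prove_definable
  | |- definable4 _ => intros ? ? ? ? ? ? ? ? ?; prove_definable
  | |- definable _ => definable_unfold; prove_definable
  end.

Lemma definable_sat {V : structure} {n} (φ : formula n) : forall k (E : (var k -> V) -> var n -> V),
  (forall i, term (fun g => E g i)) -> definable (fun g => sat φ (E g)).
Proof.
  induction φ as [m i j|m i j|m|m φ1 IH1 φ2 IH2|m φ1 IH1 φ2 IH2|m φ1 IH1 φ2 IH2|m φ IH|m φ IH];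
  intros k E HE; simpl.
  - apply (definable_mem (fun g => E g i) (fun g => E g j)); auto.
  - apply (definable_eq (fun g => E g i) (fun g => E g j)); auto.
  - apply definable_False.
  - apply (definable_and (fun g => sat φ1 (E g)) (fun g => sat φ2 (E g))); auto.
  - apply (definable_or (fun g => sat φ1 (E g)) (fun g => sat φ2 (E g))); auto.
  - apply (definable_imp (fun g => sat φ1 (E g)) (fun g => sat φ2 (E g))); auto.
  - apply (definable_all (fun g x => sat φ (x .: E g))).
    apply (IH (S k) (fun g => g None .: E (tail g))). intro; term_solve.
  - apply (definable_ex (fun g x => sat φ (x .: E g))).
    apply (IH (S k) (fun g => g None .: E (tail g))). intro; term_solve.
Qed.

Lemma is_class3_definable {V : structure} (H : V -> V -> V -> Prop) : is_class3 H <-> definable3 H.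
Proof.
  split.
  - intros (n & φ & e & K) k a b c Ha Hb Hc.
    eapply definable_iff; [intro; apply K|].
    apply (definable_sat φ k (fun g => a g .: b g .: c g .: e)).
    intro i. term_solve.
  - intros K; destruct (definable3_formula _ K) as (n & φ & e & HH). exists n, φ, e; auto.
Qed.

(** * Set theory inside V *)

Section SetTheory.

Context {V : structure} (HV : satisfies V CZFminus).

Local Notation is_set := (@is_set V).
Local Notation small := (@small V).

Lemma V_ext (x y : V) : (forall z, z ∈ x <-> z ∈ y) -> x = y.
Proof. intros H; apply (HV _ CZF_ext x y); intros z; simpl; apply H. Qed.

Lemma V_ind (Q : V -> Prop) : definable1 Q ->
  (forall x, (forall y, y ∈ x -> Q y) -> Q x) -> forall x, Q x.
Proof.
  intros HQ H x. destruct (definable1_formula _ HQ) as (n & φ & e & K).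
  apply K. apply (sat_closure _ (HV _ (CZF_ind φ)) e). simpl.
  intros y Hy. apply K, H. intros z Hz. apply K.
  specialize (Hy z Hz). rewrite sat_ren in Hy.
  eapply sat_ext; [|exact Hy]. intros [i|]; reflexivity.
Qed.

Lemma V_coll (R : V -> V -> Prop) (a : V) : definable2 R ->
  (forall x, x ∈ a -> exists y, R x y) ->
  exists b : V, (forall x, x ∈ a -> exists y, y ∈ b /\ R x y) /\
    (forall y, y ∈ b -> exists x, x ∈ a /\ R x y).
Proof.
  intros HR H.
  assert (HR' : definable2 (fun y x => R x y)) by prove_definable.
  destruct (definable2_formula _ HR') as (n & φ & e & K).
  destruct (sat_closure _ (HV _ (CZF_coll φ)) e a) as (b & Hb1 & Hb2).
  - simpl; intros x Hx. destruct (H x Hx) as [y Hy]; exists y.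
    rewrite sat_ren. apply K in Hy. eapply sat_ext; [|exact Hy].
    intros [[i|]|]; reflexivity.
  - simpl in Hb1, Hb2. exists b; split.
    + intros x Hx; destruct (Hb1 x Hx) as (y & Hy & Hs); exists y; split; auto.
      apply K. rewrite sat_ren in Hs. eapply sat_ext; [|exact Hs].
      intros [[i|]|]; reflexivity.
    + intros y Hy; destruct (Hb2 y Hy) as (x & Hx & Hs); exists x; split; auto.
      apply K. rewrite sat_ren in Hs. eapply sat_ext; [|exact Hs].
      intros [[i|]|]; reflexivity.
Qed.

Lemma is_set_iff (A B : V -> Prop) : (forall y, B y <-> A y) -> is_set A -> is_set B.
Proof. intros H [s K]; exists s; intros; rewrite H; apply K. Qed.

Lemma is_set_mem (s : V) : is_set (fun y => y ∈ s).
Proof. exists s; tauto. Qed.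

Lemma V_delta0_sep {n} (φ : formula (S n)) (e : var n -> V) a : Delta0 φ ->
  is_set (fun x => x ∈ a /\ sat φ (x .: e)).
Proof.
  intros H. destruct (sat_closure _ (HV _ (CZF_sep H)) e a) as [b Hb].
  exists b; intros x. specialize (Hb x); simpl in Hb. rewrite sat_ren in Hb.
  rewrite (sat_ext φ _ (x .: e)) in Hb; [exact Hb|]. intros [i|]; reflexivity.
Qed.

Lemma is_set_pair (a b : V) : is_set (fun y => y = a \/ y = b).
Proof. exact (HV _ CZF_pair a b). Qed.

Lemma is_set_sing (a : V) : is_set (fun y => y = a).
Proof. eapply is_set_iff; [|apply (is_set_pair a a)]; simpl; tauto. Qed.

Lemma is_set_Union (A : V -> Prop) : is_set A -> is_set (fun y => exists x, A x /\ y ∈ x).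
Proof.
  intros [s H]. destruct (HV _ CZF_un s) as [u Hu]. exists u; intros y.
  assert (E : y ∈ u <-> exists x, x ∈ s /\ y ∈ x) by exact (Hu y). rewrite E.
  split; intros (x & Hx & Hy); exists x; split; auto; apply H; auto.
Qed.

Lemma is_set_or (A B : V -> Prop) : is_set A -> is_set B -> is_set (fun y => A y \/ B y).
Proof.
  intros [s H] [t K]. eapply is_set_iff; [|apply (is_set_Union _ (is_set_pair s t))].
  intros y; simpl; split.
  - intros [h|h]; [exists s | exists t]; split; auto; [apply H | apply K]; auto.
  - intros (x & [->| ->] & h); [left; apply H | right; apply K]; auto.
Qed.

Lemma is_set_empty : is_set (fun _ => False).
Proof.
  destruct (HV _ CZF_inf) as (x & (e & _ & He) & _). simpl in He.
  exists e; intros y; split; [apply He | tauto].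
Qed.

Lemma collection (A : V -> Prop) (R : V -> V -> Prop) : is_set A -> definable2 R ->
  (forall x, A x -> exists y, R x y) ->
  exists b : V, (forall x, A x -> exists y, y ∈ b /\ R x y) /\
    (forall y, y ∈ b -> exists x, A x /\ R x y).
Proof.
  intros [a Ha] HR H. destruct (V_coll R a HR) as (b & H1 & H2).
  - intros x Hx; apply H, Ha, Hx.
  - exists b; split.
    + intros x Hx; apply H1, Ha, Hx.
    + intros y Hy; destruct (H2 y Hy) as (x & Hx & Hr); exists x; split; auto. apply Ha, Hx.
Qed.

(** Collecting sets [g] that are exactly the class [R x] and taking their union
    leaves nothing superfluous.  Replacement and Separation are instances. *)
Lemma is_set_iUnion (A : V -> Prop) (R : V -> V -> Prop) : is_set A -> definable2 R ->
  (forall x, A x -> is_set (R x)) -> is_set (fun y => exists x, A x /\ R x y).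
Proof.
  intros HA HR H.
  destruct (collection A (fun x g => forall y, y ∈ g <-> R x y) HA) as (b & H1 & H2).
  - prove_definable.
  - exact H.
  - eapply is_set_iff; [|apply (is_set_Union _ (is_set_mem b))].
    intros y; simpl; split.
    + intros (x & Hx & Hr). destruct (H1 x Hx) as (g & Hg & K).
      exists g; split; auto. apply K, Hr.
    + intros (g & Hg & Hy). destruct (H2 g Hg) as (x & Hx & K).
      exists x; split; auto. apply K, Hy.
Qed.

Lemma is_set_repl (A : V -> Prop) (R : V -> V -> Prop) : is_set A -> definable2 R ->
  (forall x, A x -> exists y, R x y /\ forall y', R x y' -> y' = y) ->
  is_set (fun y => exists x, A x /\ R x y).
Proof.
  intros HA HR H. apply is_set_iUnion; auto.
  intros x Hx; destruct (H x Hx) as (y & Hy & Hu).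
  eapply is_set_iff; [|apply (is_set_sing y)].
  intros y'; simpl; split; auto. intros ->; auto.
Qed.

Lemma is_set_sep (A : V -> Prop) (Q : V -> Prop) : is_set A -> definable1 Q ->
  (forall x, A x -> small (Q x)) -> is_set (fun y => A y /\ Q y).
Proof.
  intros HA HQ H.
  eapply is_set_iff; [|apply (is_set_iUnion A (fun x y => y = x /\ Q x) HA)].
  - intros y; split.
    + intros [h k]; exists y; auto.
    + intros (x & h & -> & k); auto.
  - prove_definable.
  - intros x Hx; apply (H x Hx x).
Qed.

Lemma small_iff (P Q : Prop) : (Q <-> P) -> small P -> small Q.
Proof. intros H K a. eapply is_set_iff; [|apply (K a)]. intros; simpl; tauto. Qed.

Lemma small_delta0 {n} (φ : formula n) (e : var n -> V) : Delta0 (ren φ wk1) -> small (sat φ e).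
Proof.
  intros H a. destruct (is_set_sing a) as [s Hs].
  destruct (V_delta0_sep (ren φ wk1) e s H) as [t Ht].
  exists t; intros y. rewrite Ht, Hs, sat_ren. exact (iff_refl _).
Qed.

Lemma small_mem (x y : V) : small (x ∈ y).
Proof. apply (small_delta0 (Mem v0 v1) (x .: y .: snil)). constructor. Qed.

Lemma small_eq (x y : V) : small (x = y).
Proof. apply (small_delta0 (Eq v0 v1) (x .: y .: snil)). constructor. Qed.

Lemma small_False : small False.
Proof. intros a. eapply is_set_iff; [|apply is_set_empty]. simpl; tauto. Qed.

Lemma small_and (P Q : Prop) : small P -> small Q -> small (P /\ Q).
Proof.
  intros HP HQ a. destruct (HQ a) as [t Ht].
  eapply is_set_iff; [|apply (is_set_sep _ (fun y => y ∈ t) (HP a))].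
  - intros y; simpl. rewrite Ht; tauto.
  - prove_definable.
  - intros; apply small_mem.
Qed.

Lemma small_or (P Q : Prop) : small P -> small Q -> small (P \/ Q).
Proof.
  intros HP HQ a.
  eapply is_set_iff; [|apply (is_set_or _ _ (HP a) (HQ a))]. intros; simpl; tauto.
Qed.

(** With the truth values [s] and [t] of the two sides formed as sets, the
    implication becomes the Δ0 statement [a ∈ s -> a ∈ t]. *)
Lemma small_imp (P Q : Prop) : small P -> small Q -> small (P -> Q).
Proof.
  intros HP HQ a. destruct (HP a) as [s Hs], (HQ a) as [t Ht].
  eapply small_iff.
  2: { apply (small_delta0 (Imp (Mem v0 v1) (Mem v0 v2)) (a .: s .: t .: snil)).
       repeat constructor. }
  simpl. rewrite Hs, Ht. tauto.
Qed.

(** By Replacement the truth values of the [Q x] form a set [b], and the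
    quantifier becomes the Δ0 statement that [a] is in every member of [b]. *)
Lemma small_all (A : V -> Prop) (Q : V -> Prop) : is_set A -> definable1 Q ->
  (forall x, A x -> small (Q x)) -> small (forall x, A x -> Q x).
Proof.
  intros HA HQ H a.
  destruct (is_set_iUnion A (fun x t => forall z, z ∈ t <-> z = a /\ Q x) HA)
    as [b Hb].
  - prove_definable.
  - intros x Hx. destruct (H x Hx a) as [t Ht].
    eapply is_set_iff; [|apply (is_set_sing t)].
    intros t'; simpl; split.
    + intros K; apply V_ext; intros z; rewrite K, Ht; tauto.
    + intros ->; auto.
  - eapply small_iff.
    2: { apply (small_delta0 (BAll v0 (Mem v2 v0)) (b .: a .: snil)).
         unfold BAll; simpl. apply (D0_BAll v1). constructor. }
    simpl. split.
    + intros K t Ht. apply Hb in Ht. destruct Ht as (x & Hx & Ht).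
      apply Ht. auto.
    + intros K x Hx. destruct (H x Hx a) as [t Ht].
      apply (Ht a), K, Hb. exists x; split; auto.
Qed.

Lemma small_ex (A : V -> Prop) (Q : V -> Prop) : is_set A -> definable1 Q ->
  (forall x, A x -> small (Q x)) -> small (exists x, A x /\ Q x).
Proof.
  intros HA HQ H a.
  eapply is_set_iff; [|apply (is_set_iUnion A (fun x y => y = a /\ Q x) HA)].
  - intros y; split.
    + intros (-> & x & h & k); exists x; auto.
    + intros (x & h & -> & k); split; eauto.
  - prove_definable.
  - intros x Hx; apply (H x Hx a).
Qed.

Lemma upair_ex (a b : V) : exists c : V, is_upair a b c.
Proof. apply is_set_pair. Qed.

Lemma upair_uniq (a b c c' : V) : is_upair a b c -> is_upair a b c' -> c = c'.
Proof. intros H K; apply V_ext; intros z; rewrite (H z), (K z); tauto. Qed.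

Lemma opair_ex (a b : V) : exists c : V, is_opair a b c.
Proof.
  destruct (upair_ex a a) as [s Hs], (upair_ex a b) as [t Ht], (upair_ex s t) as [c Hc].
  exists c; intros z. rewrite (Hc z). split; intros [h|h].
  - subst; auto.
  - subst; auto.
  - left; eapply upair_uniq; eauto.
  - right; eapply upair_uniq; eauto.
Qed.

Lemma opair_uniq (a b c c' : V) : is_opair a b c -> is_opair a b c' -> c = c'.
Proof. intros H K; apply V_ext; intros z; rewrite (H z), (K z); tauto. Qed.

(** The two cases for [{a, b}], being [{a'}] or [{a', b'}], are compared without
    deciding whether [a = b]. *)
Lemma opair_inj (a b a' b' c : V) : is_opair a b c -> is_opair a' b' c -> a = a' /\ b = b'.
Proof.
  intros H K.
  assert (E : forall z, is_upair a a z \/ is_upair a b z <-> is_upair a' a' z \/ is_upair a' b' z).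
  { intros z; rewrite <- (H z); apply K. }
  destruct (upair_ex a a) as [s Hs].
  assert (Ea : a = a').
  { destruct (proj1 (E s) (or_introl Hs)) as [h|h].
    - assert (X : a' ∈ s) by (apply h; auto). apply Hs in X. destruct X; auto.
    - assert (X : a' ∈ s) by (apply h; auto). apply Hs in X. destruct X; auto. }
  subst a'. split; auto.
  destruct (upair_ex a b) as [t Ht], (upair_ex a b') as [t' Ht'].
  destruct (proj1 (E t) (or_intror Ht)) as [h|h].
  - assert (X : b ∈ t) by (apply Ht; auto). apply h in X.
    assert (Eb : b = a) by tauto. subst b.
    destruct (proj2 (E t') (or_intror Ht')) as [k|k];
    assert (Y : b' ∈ t') by (apply Ht'; auto); apply k in Y; destruct Y; auto.
  - assert (X : b ∈ t) by (apply Ht; auto). apply h in X.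
    destruct X as [X|X]; auto. subst b.
    assert (Y : b' ∈ t) by (apply h; auto). apply Ht in Y. destruct Y; auto.
Qed.

Lemma is_set_sigma (A : V -> Prop) (B : V -> V -> Prop) : is_set A -> definable2 B ->
  (forall x, A x -> is_set (B x)) ->
  is_set (fun c => exists x y, A x /\ B x y /\ is_opair x y c).
Proof.
  intros HA HB H.
  eapply is_set_iff; [|apply (is_set_iUnion A (fun x c => exists y, B x y /\ is_opair x y c) HA)].
  - intros c; simpl; firstorder.
  - prove_definable.
  - intros x Hx. apply is_set_repl; auto.
    + prove_definable.
    + intros y Hy; destruct (opair_ex x y) as [c Hc]; exists c; split; auto.
      intros; eapply opair_uniq; eauto.
Qed.

End SetTheory.

(** * Classes defined by a local step *)

Section Inductive.

Context {V : structure} (HV : satisfies V CZFminus).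

Lemma is_otriple_ex (a b c : V) : exists d, is_otriple a b c d.
Proof.
  destruct (opair_ex HV a b) as [e He], (opair_ex HV e c) as [d Hd].
  exists d, e; auto.
Qed.

Lemma is_otriple_inj (a b c a' b' c' d : V) : is_otriple a b c d -> is_otriple a' b' c' d ->
  a = a' /\ b = b' /\ c = c'.
Proof.
  intros (e & H1 & H2) (e' & K1 & K2).
  destruct (opair_inj HV _ _ _ _ _ H2 K2); subst e' c'.
  destruct (opair_inj HV _ _ _ _ _ H1 K1); auto.
Qed.

Context (Γ : (V -> V -> V -> Prop) -> V -> V -> V -> Prop).

(** A set of triples each of which is justified by others in the set. *)
Definition postfixed (G : V) : Prop := forall a b c, otriple_in G a b c -> Γ (otriple_in G) a b c.

(** The union of all self-justifying sets, which is a class because it quantifies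
    over sets only. *)
Definition gfp (a b c : V) : Prop := exists G, otriple_in G a b c /\ postfixed G.

Context (Γ_mono : forall H H' : V -> V -> V -> Prop,
  (forall a b c, H a b c -> H' a b c) -> forall a b c, Γ H a b c -> Γ H' a b c).
Context (Γ_definable : forall k (G a b c : (var k -> V) -> V),
  term G -> term a -> term b -> term c -> definable (fun g => Γ (otriple_in (G g)) (a g) (b g) (c g))).
Context (Γ_local : forall H, definable3 H -> forall a b c, Γ H a b c -> exists G,
  (forall d, d ∈ G -> exists a b c, is_otriple a b c d /\ H a b c) /\ Γ (otriple_in G) a b c).

Lemma postfixed_definable : definable1 postfixed.
Proof.
  intros k G HG. unfold postfixed.
  apply (definable_all (fun g a => forall b c, otriple_in (G g) a b c -> Γ (otriple_in (G g)) a b c)).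
  apply (definable_all (fun g b => forall c, otriple_in (G (tail g)) (g None) b c ->
    Γ (otriple_in (G (tail g))) (g None) b c)).
  apply (definable_all (fun g c => otriple_in (G (tail (tail g))) (tail g None) (g None) c ->
    Γ (otriple_in (G (tail (tail g)))) (tail g None) (g None) c)).
  apply definable_imp; [prove_definable|].
  apply (Γ_definable (S (S (S k))) (fun g => G (tail (tail (tail g)))) (fun g => tail (tail g) None)
    (fun g => tail g None) (fun g => g None)); term_solve.
Qed.

Lemma gfp_definable : definable3 gfp.
Proof. pose proof postfixed_definable. unfold gfp. prove_definable. Qed.

Lemma gfp_unfold a b c : gfp a b c -> Γ gfp a b c.
Proof.
  intros (G & H & K). apply (Γ_mono (otriple_in G)); [|apply K, H].
  intros x y z Hx; exists G; auto.
Qed.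

(** By locality the step uses a set [G] of triples from [gfp].  Strong Collection
    gathers self-justifying sets around all of them, and adding the new triple to
    their union keeps it self-justifying. *)
Lemma gfp_fold a b c : Γ gfp a b c -> gfp a b c.
Proof.
  intros H. pose proof postfixed_definable as PF.
  destruct (Γ_local _ gfp_definable _ _ _ H) as (G & HG & HΓ).
  destruct (collection HV (fun d => d ∈ G)
    (fun d S => exists x y z, is_otriple x y z d /\ otriple_in S x y z /\ postfixed S)
    (is_set_mem G)) as (B & HB1 & HB2).
  - prove_definable.
  - intros d Hd. destruct (HG d Hd) as (x & y & z & Hc & S & HS). exists S, x, y, z; auto.
  - destruct (is_otriple_ex a b c) as [d0 Hd0].
    destruct (is_set_or HV _ _ (is_set_Union HV _ (is_set_mem B)) (is_set_sing HV d0)) as [U HU].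
    assert (HSU : forall S x y z, S ∈ B -> otriple_in S x y z -> otriple_in U x y z).
    { intros S x y z HS (d & Hd & Hi). exists d; split; auto. apply HU. left; eauto. }
    exists U; split.
    + exists d0; split; auto. apply HU; auto.
    + intros x y z (d & Hd & Hi). apply HU in Hi. destruct Hi as [(S & HS & Hi)|Hi].
      * apply (Γ_mono (otriple_in S)); [intros; eauto|].
        destruct (HB2 S HS) as (_ & _ & _ & _ & _ & _ & _ & HP).
        apply HP. exists d; auto.
      * subst d. destruct (is_otriple_inj _ _ _ _ _ _ _ Hd Hd0) as (-> & -> & ->).
        apply (Γ_mono (otriple_in G)); auto.
        intros x y z (d & Hd' & Hi). destruct (HB1 d Hi) as (S & HS & x' & y' & z' & Hc & HT & _).
        destruct (is_otriple_inj _ _ _ _ _ _ _ Hd' Hc) as (-> & -> & ->). eauto.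
Qed.

End Inductive.

(** * Functions on upper sets and the universe of names *)

Section Universe.

Context {V : structure} (HV : satisfies V CZFminus) (P : frame V).

Local Notation is_set := (@is_set V).
Local Notation small := (@small V).

Lemma le_refl p : p ∈ nodes P -> le P p p.
Proof. apply order_refl. Qed.

Lemma le_trans p q r : le P p q -> le P q r -> le P p r.
Proof. apply order_trans. Qed.

Lemma le_nodes p q : le P p q -> p ∈ nodes P /\ q ∈ nodes P.
Proof.
  intros (c & Hc & Hi). destruct (order_rel Hi) as (p' & q' & Hp & Hq & K).
  destruct (opair_inj HV _ _ _ _ _ Hc K); subst; auto.
Qed.

Lemma small_le p q : small (le P p q).
Proof.
  destruct (opair_ex HV p q) as [c Hc].
  apply (small_iff (c ∈ order P)); [|apply small_mem, HV].
  split.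
  - intros (c' & Hc' & Hi). rewrite (opair_uniq HV _ _ _ _ Hc Hc'). auto.
  - intros; exists c; auto.
Qed.

Lemma is_set_up p : is_set (le P p).
Proof.
  apply (is_set_iff (fun q => q ∈ nodes P /\ le P p q)).
  - intros q; split; [|tauto]. intros H; split; auto. apply (le_nodes _ _ H).
  - apply (is_set_sep HV); [apply is_set_mem | prove_definable | intros; apply small_le].
Qed.

Lemma fun_value p x q : function_on_up P p x -> le P p q ->
  exists s, pair_in q s x /\ forall y, in_app y x q <-> y ∈ s.
Proof.
  intros [_ H] Hq. destruct (H q Hq) as (s & Hs & Hu). exists s; split; auto.
  intros y; split.
  - intros (s' & Hs' & Hy). rewrite (Hu _ Hs'). auto.
  - intros Hy; exists s; auto.
Qed.

Lemma is_set_values p x q : function_on_up P p x -> le P p q -> is_set (fun y => in_app y x q).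
Proof.
  intros H Hq; destruct (fun_value _ _ _ H Hq) as (s & _ & Hs).
  exists s; intros y; symmetry; apply Hs.
Qed.

Lemma small_value p x q y : function_on_up P p x -> le P p q -> small (in_app y x q).
Proof.
  intros H Hq; destruct (fun_value _ _ _ H Hq) as (s & _ & Hs).
  apply (small_iff (y ∈ s)); [apply Hs | apply small_mem, HV].
Qed.

Lemma eq_app_iff p p' x x' q : function_on_up P p x -> function_on_up P p' x' ->
  le P p q -> le P p' q ->
  eq_app x x' q <-> forall y, in_app y x q <-> in_app y x' q.
Proof.
  intros Hx Hx' Hq Hq'.
  destruct (fun_value _ _ _ Hx Hq) as (s & H & Hs).
  destruct (fun_value _ _ _ Hx' Hq') as (s' & H' & Hs'). split.
  - intros (t & Ht & Ht') y; split; intros (t' & K & Hy); exists t; split; auto.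
    + destruct Hx as [_ Hx]. destruct (Hx q Hq) as (u & _ & Hu).
      rewrite <- (Hu _ Ht), (Hu _ K). auto.
    + destruct Hx' as [_ Hx']. destruct (Hx' q Hq') as (u & _ & Hu).
      rewrite <- (Hu _ Ht'), (Hu _ K). auto.
  - intros E. exists s; split; auto.
    replace s with s'; auto. apply (V_ext HV); intros z. rewrite <- Hs, <- Hs', E. tauto.
Qed.

Lemma fun_incl p x x' : function_on_up P p x -> function_on_up P p x' ->
  (forall q, le P p q -> forall y, in_app y x q <-> in_app y x' q) ->
  forall z, z ∈ x -> z ∈ x'.
Proof.
  intros Hx Hx' E z Hz. destruct (proj1 Hx z Hz) as (q & s & Hq & Ho).
  destruct (proj2 (eq_app_iff _ _ _ _ _ Hx Hx' Hq Hq) (E q Hq)) as (t & Ht & c & Hc & Hi).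
  destruct (proj2 Hx q Hq) as (u & _ & Hu).
  assert (s = t).
  { rewrite <- (Hu t Ht). symmetry; apply Hu. exists z; auto. }
  subst t. rewrite (opair_uniq HV _ _ _ _ Ho Hc). auto.
Qed.

Lemma fun_ext p x x' : function_on_up P p x -> function_on_up P p x' ->
  (forall q, le P p q -> forall y, in_app y x q <-> in_app y x' q) -> x = x'.
Proof.
  intros Hx Hx' E. apply (V_ext HV); intros z; split.
  - apply (fun_incl p); auto.
  - apply (fun_incl p); auto. intros; symmetry; auto.
Qed.

Lemma fun_comprehension p (N : V -> V -> Prop) : definable2 N ->
  (forall q, le P p q -> is_set (N q)) ->
  exists x, function_on_up P p x /\ forall q, le P p q -> forall y, in_app y x q <-> N q y.
Proof.
  intros HN H.
  destruct (is_set_repl HV (le P p) (fun q c => exists s, (forall y, y ∈ s <-> N q y) /\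
    is_opair q s c) (is_set_up p)) as [x Hx].
  - prove_definable.
  - intros q Hq. destruct (H q Hq) as [s Hs]. destruct (opair_ex HV q s) as [c Hc].
    exists c; split; [eauto|]. intros c' (s' & Hs' & Hc').
    assert (s' = s) by (apply (V_ext HV); intros; rewrite Hs', Hs; tauto). subst.
    eapply opair_uniq; eauto.
  - assert (K : forall q s, pair_in q s x -> forall y, y ∈ s <-> N q y).
    { intros q s (c & Hc & Hi). apply Hx in Hi. destruct Hi as (q' & _ & s' & Hs & Hc').
      destruct (opair_inj HV _ _ _ _ _ Hc Hc'); subst; auto. }
    assert (L : forall q, le P p q -> exists s, pair_in q s x).
    { intros q Hq. destruct (H q Hq) as [s Hs]. destruct (opair_ex HV q s) as [c Hc].
      exists s, c; split; auto. apply Hx. exists q; split; auto. exists s; auto. }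
    exists x; repeat split.
    + intros z Hz. apply Hx in Hz. destruct Hz as (q & Hq & s & _ & Ho). exists q, s; auto.
    + intros q Hq. destruct (L q Hq) as [s Hs]. exists s; split; auto.
      intros s' Hs'. apply (V_ext HV); intros y. rewrite (K _ _ Hs), (K _ _ Hs'). tauto.
    + intros (s & Hs & Hy). apply (K _ _ Hs), Hy.
    + intros Hy. destruct (L q) as [s Hs]; auto. exists s; split; auto. apply (K _ _ Hs), Hy.
Qed.

Lemma restr_ex p x q : function_on_up P p x -> le P p q -> exists x', restr P x q x'.
Proof.
  intros Hx Hq.
  destruct (is_set_iUnion HV (le P q) (fun r z => exists s, is_opair r s z /\ z ∈ x) (is_set_up q))
    as [x' Hx'].
  - prove_definable.
  - intros r Hr. destruct (proj2 Hx r) as (s & (c & Hc & Hi) & Hu); [eapply le_trans; eauto|].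
    eapply is_set_iff; [|apply (is_set_sing HV c)]. intros z; simpl; split.
    + intros (s' & Hs' & Hz). rewrite (Hu s') in Hc; [|exists z; auto].
      eapply opair_uniq; eauto.
    + intros ->; eauto.
  - exists x'; intros z. rewrite Hx'. split.
    + intros (r & Hr & s & Ho & Hz). eauto 6.
    + intros (Hz & r & s & Hr & Ho); eauto 6.
Qed.

Lemma restr_uniq x q y y' : restr P x q y -> restr P x q y' -> y = y'.
Proof. intros H K; apply (V_ext HV); intros z; rewrite (H z), (K z); tauto. Qed.

Lemma restr_pair_in x q x' : restr P x q x' -> forall r s,
  pair_in r s x' <-> le P q r /\ pair_in r s x.
Proof.
  intros H r s; split.
  - intros (c & Hc & Hi). apply H in Hi. destruct Hi as (Hi & t & s' & Ht & Ho).
    destruct (opair_inj HV _ _ _ _ _ Hc Ho); subst. split; auto. exists c; auto.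
  - intros (Hr & c & Hc & Hi). exists c; split; auto. apply H; eauto.
Qed.

Lemma restr_app x q x' : restr P x q x' -> forall r, le P q r ->
  forall y, in_app y x' r <-> in_app y x r.
Proof.
  intros H r Hr y. unfold in_app. 
  split; intros (s & Hs & Hy); exists s; split; auto;
  apply (restr_pair_in _ _ _ H) in Hs || apply (restr_pair_in _ _ _ H); tauto.
Qed.

Lemma restr_fun p x q x' : function_on_up P p x -> le P p q -> restr P x q x' ->
  function_on_up P q x'.
Proof.
  intros Hx Hq H; split.
  - intros z Hz. apply H in Hz. destruct Hz as (_ & r & s & Hr & Ho); eauto.
  - intros r Hr. destruct (proj2 Hx r) as (s & Hs & Hu); [eapply le_trans; eauto|].
    exists s; split.
    + apply (restr_pair_in _ _ _ H); auto.
    + intros s' Hs'. apply Hu. apply (restr_pair_in _ _ _ H) in Hs'; tauto.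
Qed.

(** Lets a restriction be recognized by its values, with no reference to pairs. *)
Lemma restr_intro p x q x' : function_on_up P p x -> le P p q -> function_on_up P q x' ->
  (forall r, le P q r -> forall y, in_app y x r <-> in_app y x' r) -> restr P x q x'.
Proof.
  intros Hx Hq Hx' E. destruct (restr_ex _ _ _ Hx Hq) as [x'' H].
  replace x' with x''; auto. apply (fun_ext q); auto.
  - apply (restr_fun p x); auto.
  - intros r Hr y. rewrite <- (E r Hr). eapply restr_app; eauto.
Qed.

Lemma restr_id p x : p ∈ nodes P -> function_on_up P p x -> restr P x p x.
Proof.
  intros Hp Hx. eapply restr_intro; eauto. apply le_refl; auto. tauto.
Qed.

Lemma restr_restr x q x' r x'' : le P q r -> restr P x q x' ->
  (restr P x' r x'' <-> restr P x r x'').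
Proof.
  intros Hr H.
  assert (E : forall z, (z ∈ x' /\ exists t s, le P r t /\ is_opair t s z) <->
                        (z ∈ x /\ exists t s, le P r t /\ is_opair t s z)).
  { intros z. rewrite (H z). split; [tauto|].
    intros (Hz & t & s & Ht & Ho). repeat split; eauto.
    exists t, s; split; auto. eapply le_trans; eauto. }
  split; intros K z; rewrite (K z); [|symmetry]; apply E.
Qed.

Lemma kripke_step_mono (H H' : V -> V -> V -> Prop) :
  (forall a b c, H a b c -> H' a b c) ->
  forall a b c, kripke_step P H a b c -> kripke_step P H' a b c.
Proof.
  intros M a b c (H1 & H2 & H3 & H4); repeat split; auto.
  - apply H2.
  - apply H2.
  - intros q y Hq Hy; destruct (H3 q y Hq Hy) as (β & Hb & K); eauto.
Qed.

Lemma is_set_graph p x : function_on_up P p x ->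
  is_set (fun c => exists q y, le P p q /\ in_app y x q /\ is_opair q y c).
Proof.
  intros Hx. apply (is_set_sigma HV (le P p) (fun q y => in_app y x q)).
  - apply is_set_up.
  - prove_definable.
  - intros q Hq; eapply is_set_values; eauto.
Qed.

(** The step asks for one triple for each of the set-many pairs [(q, y)] with [y] in
    [x(q)], and those triples are gathered by Strong Collection. *)
Lemma kripke_step_local (H : V -> V -> V -> Prop) : definable3 H -> forall α p x,
  kripke_step P H α p x -> exists G : V,
  (forall d, d ∈ G -> exists a b c, is_otriple a b c d /\ H a b c) /\
  kripke_step P (otriple_in G) α p x.
Proof.
  intros HH α p x (H1 & H2 & H3 & H4).
  destruct (collection HV _ (fun c d => exists q y β, is_opair q y c /\ β ∈ α /\ H β q y /\
    is_otriple β q y d) (is_set_graph _ _ H2)) as (G & HG1 & HG2).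
  - prove_definable.
  - intros c (q & y & Hq & Hy & Hc). destruct (H3 q y Hq Hy) as (β & Hb & K).
    destruct (is_otriple_ex HV β q y) as [d Hd]. exists d, q, y, β; auto.
  - exists G; split; [|repeat split; auto].
    + intros d Hd. destruct (HG2 d Hd) as (c & _ & q & y & β & _ & _ & K & Ht).
      exists β, q, y; auto.
    + apply H2.
    + apply H2.
    + intros q y Hq Hy. destruct (opair_ex HV q y) as [c Hc].
      destruct (HG1 c) as (d & Hd & q' & y' & β & Hc' & Hb & K & Ht); [eauto 6|].
      destruct (opair_inj HV _ _ _ _ _ Hc Hc'); subst q' y'.
      exists β; split; auto. exists d; auto.
Qed.

Lemma kripke_step_definable k (G a b c : (var k -> V) -> V) :
  term G -> term a -> term b -> term c ->
  definable (fun g => kripke_step P (otriple_in (G g)) (a g) (b g) (c g)).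
Proof. intros. prove_definable. Qed.

Lemma kripke_set_at_step α p x :
  kripke_step P (kripke_set_at P) α p x -> kripke_set_at P α p x.
Proof.
  intros H K HK Hcl. apply Hcl. eapply kripke_step_mono; [|exact H].
  intros a b c L; apply L; auto.
Qed.

(** [gfp] is one of the closed classes over which [kripke_set_at] intersects, hence
    one inclusion; the other is ∈-induction on [α], because a step at [α] appeals
    to members of [α] only. *)
Lemma kripke_set_at_gfp α p x : kripke_set_at P α p x <-> gfp (kripke_step P) α p x.
Proof.
  split.
  - intros H. apply H.
    + apply is_class3_definable, gfp_definable. apply kripke_step_definable.
    + apply gfp_fold; auto.
      * apply kripke_step_mono.
      * apply kripke_step_definable.
      * apply kripke_step_local.
  - intros H K HK Hcl. apply is_class3_definable in HK.
    assert (HG : definable3 (gfp (kripke_step P))) by (apply gfp_definable, kripke_step_definable).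
    revert p x H.
    apply (V_ind HV (fun α => forall p x, gfp (kripke_step P) α p x -> K α p x)).
    + prove_definable.
    + intros δ IH p x H. apply Hcl. apply gfp_unfold in H; [|apply kripke_step_mono].
      destruct H as (H1 & H2 & H3 & H4). repeat split; auto.
      * apply H2.
      * apply H2.
      * intros q y Hq Hy; destruct (H3 q y Hq Hy) as (β & Hb & L); eauto.
Qed.

Lemma kripke_set_at_definable : definable3 (kripke_set_at P).
Proof.
  intros k a b c Ha Hb Hc. eapply definable_iff; [intro; apply kripke_set_at_gfp|].
  apply (gfp_definable _ kripke_step_definable); auto.
Qed.

Lemma kripke_set_definable : definable2 (kripke_set P).
Proof. pose proof kripke_set_at_definable. unfold kripke_set. prove_definable. Qed.

Lemma kripke_set_at_unfold α p x :
  kripke_set_at P α p x -> kripke_step P (kripke_set_at P) α p x.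
Proof.
  intros H. apply (proj1 (kripke_set_at_gfp _ _ _)) in H.
  eapply kripke_step_mono; [|exact (gfp_unfold _ kripke_step_mono _ _ _ H)]. intros; apply kripke_set_at_gfp; auto.
Qed.

Local Notation D := (kripke_set P).

Lemma D_node p x : D p x -> p ∈ nodes P.
Proof. intros (α & _ & H). apply (kripke_set_at_unfold _ _ _ H). Qed.

Lemma D_fun p x : D p x -> function_on_up P p x.
Proof. intros (α & _ & H). apply (kripke_set_at_unfold _ _ _ H). Qed.

Lemma ordinal_in (α β : V) : ordinal α -> β ∈ α -> ordinal β.
Proof.
  intros [H K] Hb; split; auto. intros x Hx; apply K. eapply H; eauto.
Qed.

Lemma D_elem p x q y : D p x -> le P p q -> in_app y x q -> D q y.
Proof.
  intros (α & Ho & H) Hq Hy. destruct (kripke_set_at_unfold _ _ _ H) as (_ & _ & K & _).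
  destruct (K q y Hq Hy) as (β & Hb & L). exists β; split; auto. eapply ordinal_in; eauto.
Qed.

Lemma D_mono p x q r y y' : D p x -> le P p q -> le P q r -> in_app y x q ->
  restr P y r y' -> in_app y' x r.
Proof.
  intros (α & Ho & H) Hq Hr Hy Hy'.
  destruct (kripke_set_at_unfold _ _ _ H) as (_ & _ & _ & K). eauto.
Qed.

Lemma D_restr p x q x' : D p x -> le P p q -> restr P x q x' -> D q x'.
Proof.
  intros (α & Ho & H) Hq Hx'. exists α; split; auto. apply kripke_set_at_step.
  destruct (kripke_set_at_unfold _ _ _ H) as (_ & K1 & K2 & K3).
  assert (F : function_on_up P q x') by (eapply restr_fun; eauto).
  split; [apply (le_nodes _ _ Hq)|split; [exact F|split]].
  - intros r y Hr Hy. apply (K2 r); [eapply le_trans; eauto|].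
    apply (restr_app _ _ _ Hx'); auto.
  - intros r t y y' Hr Ht Hy Hy'. 
    apply (restr_app _ _ _ Hx'); [eapply le_trans; eauto|].
    apply (K3 r t y y'); auto; [eapply le_trans; eauto|].
    apply (restr_app _ _ _ Hx'); auto.
Qed.

(** Strong Collection yields a set [B] of ordinals at whose levels all the values of
    [x] occur; the ordinal [⋃B ∪ B] lies above each of them. *)
Lemma D_intro p x : p ∈ nodes P -> function_on_up P p x ->
  (forall q y, le P p q -> in_app y x q -> D q y) ->
  (forall q r y y', le P p q -> le P q r -> in_app y x q -> restr P y r y' ->
    in_app y' x r) -> D p x.
Proof.
  intros Hp Hx H K. pose proof kripke_set_at_definable as HK.
  destruct (collection HV _ (fun c β => exists q y, is_opair q y c /\ ordinal β /\
    kripke_set_at P β q y) (is_set_graph _ _ Hx)) as (B & HB1 & HB2).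
  - prove_definable.
  - intros c (q & y & Hq & Hy & Hc). destruct (H q y Hq Hy) as (β & Hb & L).
    exists β, q, y; auto.
  - destruct (is_set_or HV _ _ (is_set_Union HV _ (is_set_mem B)) (is_set_mem B)) as [α Hα].
    assert (HB : forall β, β ∈ B -> ordinal β).
    { intros β Hβ; destruct (HB2 β Hβ) as (_ & _ & _ & _ & _ & Hb & _); auto. }
    exists α; split; [split|].
    + intros β γ Hβ Hγ. apply Hα. apply Hα in Hβ. left. destruct Hβ as [(δ & Hδ & Hβ)|Hβ].
      * exists δ; split; auto. eapply (proj1 (HB δ Hδ)); eauto.
      * exists β; auto.
    + intros β Hβ. apply Hα in Hβ. destruct Hβ as [(δ & Hδ & Hβ)|Hβ].
      * apply (proj2 (HB δ Hδ)); auto.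
      * apply (proj1 (HB β Hβ)).
    + apply kripke_set_at_step. split; [auto|split; [auto|split; [|auto]]].
      intros q y Hq Hy. destruct (opair_ex HV q y) as [c Hc].
      destruct (HB1 c) as (β & Hβ & q' & y' & Hc' & _ & L); [eauto 6|].
      destruct (opair_inj HV _ _ _ _ _ Hc Hc'); subst q' y'.
      exists β; split; auto. apply Hα; auto.
Qed.

(** Members of a name occur at earlier levels, so this is ∈-induction on the
    level. *)
Lemma D_ind (Q : V -> V -> Prop) : definable2 Q ->
  (forall p x, D p x -> (forall q y, le P p q -> in_app y x q -> Q q y) -> Q p x) ->
  forall p x, D p x -> Q p x.
Proof.
  intros HQ H p x (α & Ho & Hx). pose proof kripke_set_at_definable as HK.
  revert p x Ho Hx. 
  apply (V_ind HV (fun α => forall p x, ordinal α -> kripke_set_at P α p x -> Q p x)).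
  - prove_definable.
  - intros β IH p x Ho Hx. apply H; [exists β; auto|].
    intros q y Hq Hy. destruct (kripke_set_at_unfold _ _ _ Hx) as (_ & _ & K & _).
    destruct (K q y Hq Hy) as (γ & Hγ & L). apply (IH γ); auto. eapply ordinal_in; eauto.
Qed.

(** The source of all the names that the axioms ask for, through a suitable [N]. *)
Lemma D_comprehension p (N : V -> V -> Prop) : p ∈ nodes P -> definable2 N ->
  (forall q, le P p q -> is_set (N q)) ->
  (forall q y, le P p q -> N q y -> D q y) ->
  (forall q r y y', le P p q -> le P q r -> N q y -> restr P y r y' -> N r y') ->
  exists x, D p x /\ forall q, le P p q -> forall y, in_app y x q <-> N q y.
Proof.
  intros Hp HN H1 H2 H3. destruct (fun_comprehension p N HN H1) as (x & Hx & K).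
  exists x; split; auto. apply D_intro; auto.
  - intros q y Hq Hy. apply H2; auto. apply K; auto.
  - intros q r y y' Hq Hr Hy Hy'. apply K; [eapply le_trans; eauto|].
    apply (H3 q r y y'); auto. apply K; auto.
Qed.

End Universe.

(** * Forcing with unrestricted environments *)

Section Forcing.

Context {V : structure} (HV : satisfies V CZFminus) (P : frame V).

Local Notation is_set := (@is_set V).
Local Notation D := (kripke_set P).

(** A name given at a lower node denotes at [p] by way of its restriction. *)
Definition denotes (p x : V) : Prop := exists r, le P r p /\ D r x.

Definition mem_at (p x y : V) : Prop := exists x', restr P x p x' /\ in_app x' y p.

Definition eq_at (p x y : V) : Prop := forall q, le P p q -> eq_app x y q.

Definition denotes_env (p : V) {n} (e : var n -> V) : Prop := forall i, denotes p (e i).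

Lemma denotes_node p x : denotes p x -> p ∈ nodes P.
Proof. intros (r & Hr & _). apply (le_nodes HV _ _ _ Hr). Qed.

Lemma D_denotes p x : D p x -> denotes p x.
Proof. intros H; exists p; split; auto. apply le_refl. eapply D_node; eauto. Qed.

Lemma denotes_le p q x : denotes p x -> le P p q -> denotes q x.
Proof. intros (r & Hr & H) Hq; exists r; split; auto. eapply le_trans; eauto. Qed.

Lemma denotes_env_le p q n (e : var n -> V) : denotes_env p e -> le P p q -> denotes_env q e.
Proof. intros H Hq i; eapply denotes_le; eauto. Qed.

Lemma denotes_env_cons p n x (e : var n -> V) :
  denotes p x -> denotes_env p e -> denotes_env p (x .: e).
Proof. intros Hx He [i|]; simpl; auto. Qed.

Lemma denotes_restr_ex p x : denotes p x -> exists x', restr P x p x' /\ D p x'.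
Proof.
  intros (r & Hr & H). destruct (restr_ex HV P _ _ _ (D_fun HV _ _ _ H) Hr) as [x' Hx'].
  exists x'; split; auto. eapply D_restr; eauto.
Qed.

Lemma denotes_restr p x x' : denotes p x -> restr P x p x' -> D p x'.
Proof. intros (r & Hr & H) Hx'. eapply D_restr; eauto. Qed.

Lemma denotes_elem p x y : denotes p x -> in_app y x p -> D p y.
Proof. intros (r & Hr & H). eapply D_elem; eauto. Qed.

Lemma denotes_is_set p x : denotes p x -> is_set (fun y => in_app y x p).
Proof. intros (r & Hr & H). eapply is_set_values; eauto. eapply D_fun; eauto. Qed.

Lemma denotes_mono p x q y y' : denotes p x -> le P p q -> in_app y x p -> restr P y q y' ->
  in_app y' x q.
Proof. intros (r & Hr & H) Hq Hy Hy'. eapply D_mono; eauto. Qed.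

Lemma eq_at_iff p x y : denotes p x -> denotes p y ->
  (eq_at p x y <-> forall q, le P p q -> forall z, in_app z x q <-> in_app z y q).
Proof.
  intros (r & Hr & Hx) (r' & Hr' & Hy).
  assert (L : forall q, le P p q ->
    (eq_app x y q <-> forall z, in_app z x q <-> in_app z y q)).
  { intros q Hq. apply (eq_app_iff HV P r r'); try (eapply D_fun; eauto);
    eapply le_trans; eauto. }
  split; intros H q Hq; apply L; auto.
Qed.

Lemma eq_at_refl p x : denotes p x -> eq_at p x x.
Proof. intros H. apply eq_at_iff; auto. tauto. Qed.

Lemma eq_at_sym p x y : eq_at p x y -> eq_at p y x.
Proof. intros H q Hq. destruct (H q Hq) as (s & H1 & H2); exists s; auto. Qed.

Lemma eq_at_trans p x y z : denotes p x -> denotes p y -> denotes p z ->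
  eq_at p x y -> eq_at p y z -> eq_at p x z.
Proof.
  intros Hx Hy Hz H1 H2. rewrite eq_at_iff in *; auto.
  intros q Hq u. rewrite H1, H2; tauto.
Qed.

Lemma eq_at_le p q x y : eq_at p x y -> le P p q -> eq_at q x y.
Proof. intros H Hq r Hr; apply H. eapply le_trans; eauto. Qed.

Lemma eq_at_restr p x x' : denotes p x -> restr P x p x' -> eq_at p x x'.
Proof.
  intros H Hx'. apply eq_at_iff; auto. { apply D_denotes. eapply denotes_restr; eauto. }
  intros q Hq z. symmetry. apply (restr_app HV _ _ _ _ Hx' _ Hq).
Qed.

Lemma eq_at_eq p x y : D p x -> D p y -> eq_at p x y -> x = y.
Proof.
  intros Hx Hy H. apply (fun_ext HV P p); try (eapply D_fun; eauto).
  apply eq_at_iff; auto; apply D_denotes; auto.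
Qed.

(** Names equal at [p] have the same restriction to [p]: their restrictions are
    functions on the same domain with the same values. *)
Lemma eq_at_restr_eq p x y x' : denotes p x -> denotes p y -> eq_at p x y ->
  restr P x p x' -> restr P y p x'.
Proof.
  intros Hx Hy H Hx'. destruct (denotes_restr_ex _ _ Hy) as (y' & Hy' & HD).
  assert (HD' : D p x') by exact (denotes_restr _ _ _ Hx Hx').
  replace x' with y'; auto. apply (eq_at_eq p); auto.
  apply (eq_at_trans _ _ y); auto using D_denotes. apply eq_at_sym, eq_at_restr; auto.
  apply (eq_at_trans _ _ x); auto using D_denotes, eq_at_sym. apply eq_at_restr; auto.
Qed.

Lemma D_restr_id p x : D p x -> restr P x p x.
Proof.
  intros H. apply (restr_id HV). eapply D_node; eauto. eapply D_fun; eauto.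
Qed.

Lemma mem_at_D p x y : D p x -> (mem_at p x y <-> in_app x y p).
Proof.
  intros H. split.
  - intros (x' & Hx' & Hi). rewrite (restr_uniq HV _ _ _ _ _ (D_restr_id _ _ H) Hx'). auto.
  - intros Hi; exists x; split; auto. apply D_restr_id; auto.
Qed.

Fixpoint force {n} (φ : formula n) : V -> (var n -> V) -> Prop :=
  match φ in formula n return V -> (var n -> V) -> Prop with
  | Mem i j => fun p e => mem_at p (e i) (e j)
  | Eq i j  => fun p e => eq_at p (e i) (e j)
  | Bot     => fun _ _ => False
  | And ψ χ => fun p e => force ψ p e /\ force χ p e
  | Or ψ χ  => fun p e => force ψ p e \/ force χ p e
  | Imp ψ χ => fun p e => forall q, le P p q -> force ψ q e -> force χ q e
  | All ψ   => fun p e => forall q, le P p q -> forall x, D q x -> force ψ q (x .: e)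
  | Ex ψ    => fun p e => exists x, D p x /\ force ψ p (x .: e)
  end.

Lemma force_ren {m} (φ : formula m) : forall n (f : var m -> var n) p e e',
  (forall i, e (f i) = e' i) -> force (ren φ f) p e <-> force φ p e'.
Proof.
  induction φ as [m i j|m i j|m|m φ1 IH1 φ2 IH2|m φ1 IH1 φ2 IH2|m φ1 IH1 φ2 IH2|m φ IH|m φ IH];
  intros n f p e e' H; simpl.
  - rewrite !H; tauto.
  - rewrite !H; tauto.
  - tauto.
  - rewrite (IH1 _ _ p _ _ H), (IH2 _ _ p _ _ H); tauto.
  - rewrite (IH1 _ _ p _ _ H), (IH2 _ _ p _ _ H); tauto.
  - split; intros L q Hq; [rewrite <- (IH1 _ _ q _ _ H), <- (IH2 _ _ q _ _ H)
      | rewrite (IH1 _ _ q _ _ H), (IH2 _ _ q _ _ H)]; auto.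
  - split; intros L q Hq x Hx; specialize (L q Hq x Hx); revert L; apply IH;
    intros [i|]; simpl; auto.
  - split; intros (x & Hx & L); exists x; (split; [auto|]);
    revert L; apply IH; intros [i|]; simpl; auto.
Qed.

Lemma force_definable {n} (φ : formula n) : forall k (p : (var k -> V) -> V)
  (G : (var k -> V) -> var n -> V),
  term p -> (forall i, term (fun g => G g i)) -> definable (fun g => force φ (p g) (G g)).
Proof.
  pose proof (kripke_set_definable HV P) as HD.
  assert (HM : definable3 mem_at) by (unfold mem_at; prove_definable).
  assert (HE : definable3 eq_at) by (unfold eq_at; prove_definable).
  induction φ as [m i j|m i j|m|m φ1 IH1 φ2 IH2|m φ1 IH1 φ2 IH2|m φ1 IH1 φ2 IH2|m φ IH|m φ IH];
  intros k p G Hp HG; simpl.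
  - apply (HM k p (fun g => G g i) (fun g => G g j)); auto.
  - apply (HE k p (fun g => G g i) (fun g => G g j)); auto.
  - apply definable_False.
  - apply (definable_and (fun g => force φ1 (p g) (G g)) (fun g => force φ2 (p g) (G g))); auto.
  - apply (definable_or (fun g => force φ1 (p g) (G g)) (fun g => force φ2 (p g) (G g))); auto.
  - apply (definable_all (fun g q => le P (p g) q -> force φ1 q (G g) -> force φ2 q (G g))).
    apply definable_imp; [prove_definable|]. apply definable_imp.
    + apply (IH1 (S k) (fun g => g None) (fun g => G (tail g))); [term_solve | intro; term_solve].
    + apply (IH2 (S k) (fun g => g None) (fun g => G (tail g))); [term_solve | intro; term_solve].
  - apply (definable_all (fun g q => le P (p g) q -> forall x, D q x -> force φ q (x .: G g))).
    apply definable_imp; [prove_definable|].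
    apply (definable_all (fun (g : var (S k) -> V) x =>
      D (g None) x -> force φ (g None) (x .: G (tail g)))).
    apply definable_imp; [prove_definable|].
    apply (IH (S (S k)) (fun g => tail g None) (fun g => g None .: G (tail (tail g))));
      [term_solve | intro; term_solve].
  - apply (definable_ex (fun g x => D (p g) x /\ force φ (p g) (x .: G g))).
    apply definable_and; [prove_definable|].
    apply (IH (S k) (fun g => p (tail g)) (fun g => g None .: G (tail g)));
      [term_solve | intro; term_solve].
Qed.

(** Equality is forced to be a congruence.  This is what allows a name to be traded
    for its restriction in the next lemma. *)
Lemma force_eq_at {n} (φ : formula n) : forall p e e', p ∈ nodes P ->
  denotes_env p e -> denotes_env p e' ->
  (forall i, eq_at p (e i) (e' i)) -> force φ p e -> force φ p e'.
Proof.
  induction φ as [m i j|m i j|m|m φ1 IH1 φ2 IH2|m φ1 IH1 φ2 IH2|m φ1 IH1 φ2 IH2|m φ IH|m φ IH];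
  intros p e e' Hp He He' H; simpl.
  - intros (x' & Hx' & Hi). exists x'; split.
    + eapply eq_at_restr_eq; [apply He | apply He' | apply H | auto].
    + specialize (H j). rewrite eq_at_iff in H; auto. apply H; auto. apply le_refl; auto.
  - intros L. apply (eq_at_trans _ _ (e i)); auto. apply eq_at_sym; auto.
    apply (eq_at_trans _ _ (e j)); auto.
  - tauto.
  - intros [L1 L2]; split; eauto.
  - intros [L|L]; [left|right]; eauto.
  - intros L q Hq L1.
    assert (Hn : q ∈ nodes P) by apply (le_nodes HV _ _ _ Hq).
    assert (Heq : forall i, eq_at q (e i) (e' i)) by (intros; eapply eq_at_le; eauto).
    eapply (IH2 q e); eauto using denotes_env_le. apply L; auto.
    eapply (IH1 q e'); eauto using denotes_env_le, eq_at_sym.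
  - intros L q Hq x Hx.
    assert (Hn : q ∈ nodes P) by apply (le_nodes HV _ _ _ Hq).
    apply (IH q (x .: e)); eauto using denotes_env_cons, D_denotes, denotes_env_le.
    intros [i|]; simpl; [eapply eq_at_le; eauto | apply eq_at_refl, D_denotes; auto].
  - intros (x & Hx & L). exists x; split; auto.
    apply (IH p (x .: e)); eauto using denotes_env_cons, D_denotes.
    intros [i|]; simpl; [eauto | apply eq_at_refl, D_denotes; auto].
Qed.

(** Existential witnesses at [p] are names at [p] itself; with this lemma a witness
    found lower down can be moved up. *)
Lemma force_restr {n} (φ : formula (S n)) p x x' e : denotes_env p e -> denotes p x -> restr P x p x' ->
  (force φ p (x .: e) <-> force φ p (x' .: e)).
Proof.
  intros He Hx Hr. assert (Hx' : denotes p x') by (apply D_denotes; eapply denotes_restr; eauto).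
  assert (L : eq_at p x x') by (apply eq_at_restr; auto).
  split; apply force_eq_at; auto using denotes_env_cons; try (eapply denotes_node; eauto);
  intros [i|]; simpl; auto using eq_at_refl, eq_at_sym.
Qed.

Lemma force_mono {n} (φ : formula n) : forall p q e, le P p q -> denotes_env p e ->
  force φ p e -> force φ q e.
Proof.
  induction φ as [m i j|m i j|m|m φ1 IH1 φ2 IH2|m φ1 IH1 φ2 IH2|m φ1 IH1 φ2 IH2|m φ IH|m φ IH];
  intros p q e Hq He; simpl.
  - intros (x' & Hx' & Hi).
    assert (HD : D p x') by (eapply denotes_restr; eauto).
    destruct (denotes_restr_ex q x') as (x'' & Hx'' & _).
    { eapply denotes_le; eauto. apply D_denotes; auto. }
    exists x''; split.
    + exact (proj1 (restr_restr P _ _ _ _ _ Hq Hx') Hx'').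
    + eapply denotes_mono; eauto.
  - intros L; eapply eq_at_le; eauto.
  - tauto.
  - intros [L1 L2]; split; eauto.
  - intros [L|L]; [left|right]; eauto.
  - intros L r Hr; apply L. eapply le_trans; eauto.
  - intros L r Hr; apply L. eapply le_trans; eauto.
  - intros (x & Hx & L).
    assert (Kx : denotes p x) by (apply D_denotes; auto).
    destruct (denotes_restr_ex q x) as (x' & Hx' & HD); [eapply denotes_le; eauto|].
    exists x'; split; auto. 
    apply (force_restr φ q x x'); eauto using denotes_env_le, denotes_le.
    eapply IH; eauto using denotes_env_cons.
Qed.

(** Only finitely many names have to be restricted, so no choice is involved. *)
Lemma restr_env_ex p {n} (e : var n -> V) : denotes_env p e -> exists e', restr_env P e p e'.
Proof.
  induction n; intros He.
  - exists snil; intros [].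
  - destruct (IHn (fun i => e (Some i))) as [e' He']; [intro; apply He|].
    destruct (denotes_restr_ex p (e None) (He None)) as (x & Hx & _).
    exists (x .: e'). intros [i|]; simpl; auto.
Qed.

(** Restricting an environment in stages or all at once gives the same result
    ([restr_restr]), so the restriction can be postponed to the atoms. *)
Lemma forces_iff_force {n} (φ : formula n) : forall p e e', p ∈ nodes P -> denotes_env p e ->
  restr_env P e p e' -> (forces P φ p e' <-> force φ p e).
Proof.
  induction φ as [m i j|m i j|m|m φ1 IH1 φ2 IH2|m φ1 IH1 φ2 IH2|m φ1 IH1 φ2 IH2|m φ IH|m φ IH];
  intros p e e' Hp He Hr; simpl.
  - split.
    + intros L. exists (e' i); split; auto.
      apply (restr_app HV _ _ _ _ (Hr j)); auto. apply le_refl; auto.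
    + intros (x' & Hx' & Hi). rewrite (restr_uniq HV _ _ _ _ _ (Hr i) Hx').
      apply (restr_app HV _ _ _ _ (Hr j)); auto. apply le_refl; auto.
  - assert (He' : forall i, denotes p (e' i)) by (intros; apply D_denotes; eapply denotes_restr; eauto).
    assert (L : forall i, eq_at p (e i) (e' i)) by (intros; apply eq_at_restr; auto).
    change (eq_at p (e' i) (e' j) <-> eq_at p (e i) (e j)). split; intros HE.
    + apply (eq_at_trans _ _ (e' i)); auto. apply (eq_at_trans _ _ (e' j)); auto using eq_at_sym.
    + apply (eq_at_trans _ _ (e i)); auto using eq_at_sym. apply (eq_at_trans _ _ (e j)); auto.
  - tauto.
  - rewrite (IH1 p e e'), (IH2 p e e'); tauto.
  - rewrite (IH1 p e e'), (IH2 p e e'); tauto.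
  - split.
    + intros L q Hq L1.
      assert (Hn : q ∈ nodes P) by apply (le_nodes HV _ _ _ Hq).
      destruct (restr_env_ex q e) as [e'' He'']; [eapply denotes_env_le; eauto|].
      apply (IH2 q e e''); eauto using denotes_env_le. apply L; auto.
      * intros i; exact (proj2 (restr_restr P _ _ _ _ _ Hq (Hr i)) (He'' i)).
      * apply (IH1 q e e''); eauto using denotes_env_le.
    + intros L q e'' Hq He'' L1.
      assert (Hn : q ∈ nodes P) by apply (le_nodes HV _ _ _ Hq).
      assert (Hr' : restr_env P e q e'').
      { intros i; exact (proj1 (restr_restr P _ _ _ _ _ Hq (Hr i)) (He'' i)). }
      apply (IH2 q e e''); eauto using denotes_env_le. apply L; auto.
      apply (IH1 q e e''); eauto using denotes_env_le.
  - split.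
    + intros L q Hq x Hx.
      assert (Hn : q ∈ nodes P) by apply (le_nodes HV _ _ _ Hq).
      destruct (restr_env_ex q e) as [e'' He'']; [eapply denotes_env_le; eauto|].
      apply (IH q (x .: e) (x .: e'')); eauto using denotes_env_le, denotes_env_cons, D_denotes.
      * intros [i|]; simpl; auto using D_restr_id.
      * apply L; auto. intros i; exact (proj2 (restr_restr P _ _ _ _ _ Hq (Hr i)) (He'' i)).
    + intros L q e'' Hq He'' x Hx.
      assert (Hn : q ∈ nodes P) by apply (le_nodes HV _ _ _ Hq).
      assert (Hr' : restr_env P e q e'').
      { intros i; exact (proj1 (restr_restr P _ _ _ _ _ Hq (Hr i)) (He'' i)). }
      apply (IH q (x .: e) (x .: e'')); eauto using denotes_env_le, denotes_env_cons, D_denotes.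
      intros [i|]; simpl; auto using D_restr_id.
  - assert (L : forall x, D p x -> forces P φ p (x .: e') <-> force φ p (x .: e)).
    { intros x Hx. apply IH; auto using denotes_env_cons, D_denotes.
      intros [i|]; simpl; auto. apply D_restr_id; auto. }
    split; intros (x & Hx & H); exists x; split; auto; apply L; auto.
Qed.

Definition valid {n} (φ : formula n) : Prop :=
  forall p e, p ∈ nodes P -> denotes_env p e -> force φ p e.

Lemma valid_closure {n} (φ : formula n) : valid φ -> valid (closure φ).
Proof.
  induction n; simpl; auto. intros H. apply IHn. intros p e Hp He q Hq x Hx.
  apply H; eauto using denotes_env_cons, D_denotes, denotes_env_le. apply (le_nodes HV _ _ _ Hq).
Qed.

Lemma valid_forces (φ : sentence) : valid φ -> forces P φ (bot P) snil.
Proof.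
  intros H. apply (forces_iff_force φ (bot P) snil snil); try (intros []).
  - apply bot_node.
  - apply H; [apply bot_node | intros []].
Qed.

(** A bounded quantifier ranges over actual members of [e a]: a name [x] that is
    forced into [e a] may be replaced by its restriction, which is a member. *)
Lemma force_BAll {n} (a : var n) (φ : formula (S n)) p e : denotes_env p e ->
  (force (BAll a φ) p e <->
   forall q, le P p q -> forall x, in_app x (e a) q -> force φ q (x .: e)).
Proof.
  intros He. split.
  - intros H q Hq x Hx.
    assert (Hn : q ∈ nodes P) by apply (le_nodes HV _ _ _ Hq).
    assert (HD : D q x) by (apply (denotes_elem q (e a)); [apply (denotes_le p); auto | auto]).
    apply (H q Hq x HD q); [apply le_refl; auto|].
    apply (mem_at_D q x (e a) HD), Hx.
  - intros H q Hq x Hx r Hr (x' & Hx' & Hi).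
    assert (Hpr : le P p r) by (eapply le_trans; eauto).
    apply (force_restr φ r x x'); eauto using denotes_env_le, denotes_le, D_denotes.
Qed.

Lemma force_BEx {n} (a : var n) (φ : formula (S n)) p e : denotes_env p e ->
  (force (BEx a φ) p e <-> exists x, in_app x (e a) p /\ force φ p (x .: e)).
Proof.
  intros He. split.
  - intros (x & HD & Hi & H). exists x; split; auto. apply (mem_at_D p x (e a) HD), Hi.
  - intros (x & Hx & H).
    assert (HD : D p x) by (apply (denotes_elem p (e a)); auto).
    exists x; split; auto. split; auto. apply (mem_at_D p x (e a) HD), Hx.
Qed.

End Forcing.

(** * Names generated by sets of pairs *)

Section Comprehension.

Context {V : structure} (HV : satisfies V CZFminus) (P : frame V).

Local Notation is_set := (@is_set V).
Local Notation small := (@small V).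
Local Notation D := (kripke_set P).
Local Notation denotes := (denotes P).
Local Notation denotes_env := (denotes_env P).
Local Notation mem_at := (mem_at P).
Local Notation eq_at := (eq_at P).
Local Notation force := (force P).

Lemma le_node_r p q : le P p q -> q ∈ nodes P.
Proof. intros H; apply (le_nodes HV _ _ _ H). Qed.

Lemma mem_at_restr q x x' y : denotes q x -> restr P x q x' -> (mem_at q x y <-> in_app x' y q).
Proof.
  intros Hx Hr; split.
  - intros (x'' & Hr' & Hi). rewrite (restr_uniq HV _ _ _ _ _ Hr Hr'); auto.
  - intros Hi; exists x'; auto.
Qed.

Lemma eq_at_restr_iff q x x' y : denotes q x -> denotes q y -> restr P x q x' ->
  (eq_at q x y <-> restr P y q x').
Proof.
  intros Hx Hy Hr; split.
  - intros H. apply (eq_at_restr_eq HV P q x y); auto.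
  - intros H. assert (Hx' : denotes q x') by (eapply D_denotes, denotes_restr; eauto).
    apply (eq_at_trans HV P q x x' y); auto. apply eq_at_restr; auto. apply eq_at_sym, eq_at_restr; auto.
Qed.

Lemma is_set_restr q x : denotes q x -> is_set (fun y => restr P x q y).
Proof.
  intros Hx. destruct (denotes_restr_ex HV P _ _ Hx) as (x' & Hr & _).
  eapply is_set_iff; [|apply (is_set_sing HV x')]. intros y; simpl; split.
  - intros H; apply (restr_uniq HV P x q); auto.
  - intros ->; auto.
Qed.

Lemma D_ext p x y : D p x -> D p y ->
  (forall q, le P p q -> forall z, in_app z x q <-> in_app z y q) -> x = y.
Proof. intros Hx Hy. apply (fun_ext HV P p); eapply D_fun; eauto. Qed.

(** The closure under restriction of a family [T] of names. *)
Definition generated (p : V) (T : V -> V -> Prop) (q z : V) : Prop :=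
  exists r z0, le P p r /\ le P r q /\ T r z0 /\ restr P z0 q z.

Lemma D_generated p (T : V -> V -> Prop) : p ∈ nodes P -> definable2 T ->
  (forall r, le P p r -> is_set (T r)) -> (forall r z, le P p r -> T r z -> D r z) ->
  exists y, D p y /\ forall q, le P p q -> forall z, in_app z y q <-> generated p T q z.
Proof.
  intros Hp HT Hs HD. apply (D_comprehension HV); auto.
  - unfold generated; prove_definable.
  - intros q Hq. 
    apply (is_set_iff (fun z => exists r, (le P p r /\ le P r q) /\
      exists z0, T r z0 /\ restr P z0 q z)).
    { intros z; unfold generated; split.
      - intros (r & z0 & H1 & H2 & H3 & H4); eauto 8.
      - intros (r & (H1 & H2) & z0 & H3 & H4); eauto 8. }
    apply (is_set_iUnion HV); [|prove_definable|].
    + apply (is_set_sep HV); [apply is_set_up; auto|prove_definable|]. intros; apply small_le; auto.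
    + intros r [H1 H2]. apply (is_set_iUnion HV); [auto|prove_definable|].
      intros z0 Hz. apply is_set_restr. eapply denotes_le; [|eauto]. apply D_denotes; auto.
  - intros q z Hq (r & z0 & H1 & H2 & H3 & H4).
    eapply denotes_restr; [auto| |eauto]. eapply denotes_le; [|eauto]. apply D_denotes; auto.
  - intros q t y y' Hq Ht (r & z0 & H1 & H2 & H3 & H4) Hy.
    exists r, z0. split; [auto|split; [eapply le_trans; eauto|split; [auto|]]].
    exact (proj1 (restr_restr P _ _ _ _ _ Ht H4) Hy).
Qed.

Lemma is_set_section r d : is_set (fun z => pair_in r z d).
Proof.
  apply (is_set_iff (fun z => (exists s, (exists c, c ∈ d /\ s ∈ c) /\ z ∈ s) /\ pair_in r z d)).
  - intros z; split; [|tauto]. intros H; split; auto.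
    destruct H as (c & Hc & Hi). destruct (upair_ex HV r z) as [s Hs].
    exists s; split; [exists c; split; auto; apply Hc; auto|]. apply Hs; auto.
  - apply (is_set_sep HV); [|prove_definable|].
    + apply is_set_Union, is_set_Union, is_set_mem; auto.
    + intros z _. destruct (opair_ex HV r z) as [c Hc].
      apply (small_iff (c ∈ d)); [|apply small_mem; auto]. split.
      * intros (c' & Hc' & Hi). rewrite (opair_uniq HV _ _ _ _ Hc Hc'); auto.
      * intros; exists c; auto.
Qed.

(** [d] is an arbitrary set; only those of its pairs [(t, w)] with [w] in [b(t)]
    count, which guarantees that every [d] yields a name. *)
Definition name_of_pairs (b q d y : V) : Prop :=
  D q y /\ forall r, le P q r -> forall z, in_app z y r <->
    generated q (fun t w => pair_in t w d /\ in_app w b t) r z.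

Lemma name_of_pairs_ex b q d : denotes q b -> exists y, name_of_pairs b q d y.
Proof.
  intros Hb. apply D_generated; [exact (denotes_node HV P _ _ Hb) | prove_definable | |].
  - intros r Hr. assert (Hbr : denotes r b) by (eapply denotes_le; eauto).
    apply (is_set_iff (fun z => in_app z b r /\ pair_in r z d)); [intros; tauto|].
    destruct (is_set_section r d) as [s Hs].
    apply (is_set_iff (fun z => in_app z b r /\ z ∈ s)); [intros; rewrite Hs; tauto|].
    apply (is_set_sep HV); [apply (denotes_is_set HV P); auto | prove_definable | intros; apply small_mem; auto].
  - intros r z Hr [_ H]. apply (denotes_elem HV P r b); auto. eapply denotes_le; eauto.
Qed.

Lemma name_of_pairs_definable : definable4 name_of_pairs.
Proof.
  pose proof (kripke_set_definable HV P). unfold name_of_pairs, generated. prove_definable.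
Qed.

Lemma is_set_names_of_pairs b q (A : V -> Prop) : denotes q b -> is_set A ->
  is_set (fun y => exists d, A d /\ name_of_pairs b q d y).
Proof.
  intros Hb HA. apply (is_set_repl HV); auto.
  - intros k d y Hd Hy. apply name_of_pairs_definable; auto using term_const.
  - intros d Hd. destruct (name_of_pairs_ex b q d Hb) as [y Hy]. exists y; split; auto.
    intros y' Hy'. destruct Hy as [H1 H2], Hy' as [H3 H4]. apply (D_ext q); auto.
    intros r Hr z. rewrite H2, H4; tauto.
Qed.

(** * Extensionality, Pairing, Union, Induction and Separation *)

(** Names with the same forced members have equal values at each node, since the
    members of a value are names at that node and force themselves in. *)
Lemma valid_Extensionality : valid P Extensionality.
Proof.
  intros p e Hp He q1 H1 x Hx q2 H2 y Hy q3 H3 H.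
  assert (Kx : denotes q3 x) by (eapply denotes_le; [|eauto]; eapply denotes_le; [apply D_denotes; eauto|auto]).
  assert (Ky : denotes q3 y) by (eapply denotes_le; [apply D_denotes; eauto|auto]).
  apply eq_at_iff; auto. intros r Hr z.
  split; intros Hz.
  - assert (HD : D r z) by (apply (denotes_elem HV P r x); auto; eapply denotes_le; eauto).
    apply (mem_at_D HV P r z y HD). apply (proj1 (H r Hr z HD)); [apply le_refl; eapply le_node_r; eauto|].
    apply (mem_at_D HV P r z x HD), Hz.
  - assert (HD : D r z) by (apply (denotes_elem HV P r y); auto; eapply denotes_le; eauto).
    apply (mem_at_D HV P r z x HD). apply (proj2 (H r Hr z HD)); [apply le_refl; eapply le_node_r; eauto|].
    apply (mem_at_D HV P r z y HD), Hz.
Qed.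

Lemma valid_Pairing : valid P Pairing.
Proof.
  intros p e Hp He q1 H1 x Hx q2 H2 y Hy.
  assert (Kx : forall q, le P q2 q -> denotes q x)
    by (intros; eapply denotes_le; [|eauto]; eapply denotes_le; [apply D_denotes; eauto|auto]).
  assert (Ky : forall q, le P q2 q -> denotes q y) by (intros; eapply denotes_le; [apply D_denotes; eauto|auto]).
  destruct (D_comprehension HV P q2 (fun q z => restr P x q z \/ restr P y q z)) as (c & Hc & Hcz).
  - eapply le_node_r; eauto.
  - prove_definable.
  - intros q Hq. apply (is_set_or HV); apply is_set_restr; auto.
  - intros q z Hq [H|H]; (eapply denotes_restr; [auto| |eauto]); auto.
  - intros q r z z' Hq Hr [H|H] Hz; [left|right]; exact (proj1 (restr_restr P _ _ _ _ _ Hr H) Hz).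
  - exists c; split; auto. intros q3 H3 z Hz. simpl.
    assert (L : forall q, le P q3 q -> (mem_at q z c <-> eq_at q z x \/ eq_at q z y)).
    { intros q Hq. assert (Hq' : le P q2 q) by (eapply le_trans; eauto).
      assert (Kz : denotes q z) by (eapply denotes_le; [apply D_denotes; eauto|auto]).
      destruct (denotes_restr_ex HV P _ _ Kz) as (z' & Hz' & _).
      rewrite (mem_at_restr q z z'), (eq_at_restr_iff q z z' x), (eq_at_restr_iff q z z' y); auto. }
    split; intros q Hq; apply L; auto.
Qed.

Lemma valid_Union : valid P Union.
Proof.
  intros p e Hp He q1 H1 x Hx.
  assert (Kx : forall q, le P q1 q -> denotes q x) by (intros; eapply denotes_le; [apply D_denotes; eauto|auto]).
  assert (Kx1 : forall q, le P q1 q -> forall y, in_app y x q -> D q y)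
    by (intros; eapply denotes_elem; eauto).
  destruct (D_comprehension HV P q1 (fun q z => exists y, in_app y x q /\ in_app z y q)) as (u & Hu & Huz).
  - eapply le_node_r; eauto.
  - prove_definable.
  - intros q Hq. apply (is_set_iUnion HV); [apply (denotes_is_set HV P); auto | prove_definable|].
    intros y Hy. apply (denotes_is_set HV P); eauto using D_denotes.
  - intros q z Hq (y & Hy & Hz). apply (denotes_elem HV P q y); eauto using D_denotes.
  - intros q r z z' Hq Hr (y & Hy & Hz) Hz'.
    assert (Ky : denotes q y) by eauto using D_denotes.
    destruct (denotes_restr_ex HV P r y) as (y' & Hy' & _); [eapply denotes_le; eauto|].
    exists y'; split.
    + apply (denotes_mono HV P q x r y y'); auto.
    + apply (restr_app HV _ _ _ _ Hy'); [apply le_refl; eapply le_node_r; eauto|].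
      apply (denotes_mono HV P q y r z z'); auto.
  - exists u; split; auto. intros q3 H3 z Hz.
    assert (L : forall q, le P q3 q -> (mem_at q z u <-> force (BEx v2 (Mem v1 v0)) q (z .: u .: x .: e))).
    { intros q Hq. assert (Hq' : le P q1 q) by (eapply le_trans; eauto).
      assert (Kz : denotes q z) by (eapply denotes_le; [apply D_denotes; eauto|auto]).
      destruct (denotes_restr_ex HV P _ _ Kz) as (z' & Hz' & _).
      rewrite (force_BEx HV), (mem_at_restr q z z'), (Huz q Hq'); auto.
      - split; intros (y & Hy & Hi); exists y; split; auto;
        apply (mem_at_restr q z z' y); auto.
      - repeat apply denotes_env_cons; auto.
        + eapply denotes_le; [apply D_denotes; eauto|auto].
        + intros i. eapply denotes_le; [|eauto]. eapply denotes_le; eauto. }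
    split; intros q Hq; apply L; auto.
Qed.

Lemma valid_Induction {n} (φ : formula (S n)) : valid P (Induction φ).
Proof.
  intros p e Hp He q Hq H r Hr x Hx. revert Hr.
  apply (D_ind HV P (fun r x => le P q r -> force φ r (x .: e))) with (p := r); auto.
  - intros k a b Ha Hb. apply (definable_imp (fun g => le P q (a g))); [prove_definable|].
    apply (force_definable HV P φ k a (fun g => b g .: e)); auto. intro i; term_solve.
  - clear r x Hx. intros r x Hx IH Hr. apply (H r Hr x Hx r); [apply le_refl; eapply le_node_r; eauto|].
    apply (force_BAll HV).
    + apply denotes_env_cons; [apply D_denotes; auto|]. apply (denotes_env_le P p r); auto. eapply le_trans; eauto.
    + intros t Ht y Hy. apply (force_ren P φ _ _ _ _ (y .: e)); [intros [i|]; reflexivity|].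
      apply IH; auto. eapply le_trans; eauto.
Qed.

(** Stated so as to serve both Δ0-Separation and full Separation: they differ only
    in the reason why forcing is small. *)
Lemma valid_Separation {n} (φ : formula (S n)) :
  (forall q e, q ∈ nodes P -> denotes_env q e -> small (force φ q e)) -> valid P (Separation φ).
Proof.
  intros HS p e Hp He q1 H1 a Ha.
  assert (Ka : forall q, le P q1 q -> denotes q a) by (intros; eapply denotes_le; [apply D_denotes; eauto|auto]).
  assert (HKe : forall q, le P q1 q -> denotes_env q e)
    by (intros q Hq; apply (denotes_env_le P p q); auto; eapply le_trans; eauto).
  assert (HF : forall k (q x : (var k -> V) -> V), term q -> term x ->
    definable (fun g => force φ (q g) (x g .: e))).
  { intros k q x Hq Hx. apply (force_definable HV P φ k q (fun g => x g .: e)); auto. intro i; term_solve. }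
  destruct (D_comprehension HV P q1 (fun q y => in_app y a q /\ force φ q (y .: e))) as (b & Hb & Hbz).
  - eapply le_node_r; eauto.
  - intros k q x Hq Hx. apply definable_and; [prove_definable | auto].
  - intros q Hq. apply (is_set_sep HV).
    + apply (denotes_is_set HV P); auto.
    + intros k x Hx. apply (HF k (fun _ => q)); auto using term_const.
    + intros y Hy. apply HS; [eapply le_node_r; eauto|]. apply denotes_env_cons; auto.
      apply D_denotes, (denotes_elem HV P q a); auto.
  - intros q y Hq [H _]. apply (denotes_elem HV P q a); auto.
  - intros q r y y' Hq Hr [Hy H] Hy'. 
    assert (Ky : denotes q y) by (apply D_denotes, (denotes_elem HV P q a); auto).
    assert (Hr' : le P q1 r) by (eapply le_trans; eauto).
    split; [apply (denotes_mono HV P q a r y y'); auto|].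
    apply (force_restr HV P φ r y y'); auto. eapply denotes_le; eauto.
    apply (force_mono HV P φ q r); auto. apply denotes_env_cons; auto.
  - exists b; split; auto. intros q3 H3 x Hx.
    assert (L : forall q, le P q3 q -> (mem_at q x b <->
      mem_at q x a /\ force (ren φ (v0 .: wk3)) q (x .: b .: a .: e))).
    { intros q Hq. assert (Hq' : le P q1 q) by (eapply le_trans; eauto).
      assert (Kx : denotes q x) by (eapply denotes_le; [apply D_denotes; eauto|auto]).
      destruct (denotes_restr_ex HV P _ _ Kx) as (x' & Hx' & _).
      rewrite (force_ren P φ _ _ _ _ (x .: e)); [|intros [i|]; reflexivity].
      rewrite (mem_at_restr q x x' b), (mem_at_restr q x x' a), (Hbz q Hq'), (force_restr HV P φ q x x'); auto.
      tauto. }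
    split; intros q Hq; apply L; auto.
Qed.

(** * Smallness of forcing *)

Lemma small_mem_at p x y : denotes p x -> denotes p y -> small (mem_at p x y).
Proof.
  intros Hx Hy. destruct (denotes_restr_ex HV P _ _ Hx) as (x' & Hr & _).
  apply (small_iff (in_app x' y p)); [apply mem_at_restr; auto|].
  destruct Hy as (r & Hr' & Hy). apply (small_value HV P r); auto. eapply D_fun; eauto.
Qed.

Lemma small_eq_at p x y : denotes p x -> denotes p y -> small (eq_at p x y).
Proof.
  intros Hx Hy. destruct (denotes_restr_ex HV P _ _ Hx) as (x' & Hr & HD).
  destruct (denotes_restr_ex HV P _ _ Hy) as (y' & Hr' & HD').
  apply (small_iff (x' = y')); [|apply small_eq; auto].
  rewrite (eq_at_restr_iff p x x' y); auto. split.
  - intros H; apply (restr_uniq HV P y p); auto.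
  - intros ->; auto.
Qed.

(** An implication quantifies over the set of higher nodes, and a bounded quantifier
    over that set and over the values of a name. *)
Lemma small_force_Delta0 {n} (φ : formula n) : Delta0 φ ->
  forall p e, p ∈ nodes P -> denotes_env p e -> small (force φ p e).
Proof.
  induction 1; intros p e Hp He; simpl.
  - apply small_mem_at; auto.
  - apply small_eq_at; auto.
  - apply small_False; auto.
  - apply small_and; auto.
  - apply small_or; auto.
  - apply (small_all HV (le P p) (fun q => force φ q e -> force ψ q e)).
    + apply is_set_up; auto.
    + intros k a Ha. apply definable_imp.
      * apply (force_definable HV P φ k a (fun _ => e)); auto. intro i; term_solve.
      * apply (force_definable HV P ψ k a (fun _ => e)); auto. intro i; term_solve.
    + intros q Hq. assert (q ∈ nodes P) by (eapply le_node_r; eauto).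
      apply small_imp; eauto using denotes_env_le.
  - eapply small_iff; [apply (force_BAll HV); auto|].
    assert (HF : forall k (q x : (var k -> V) -> V), term q -> term x ->
      definable (fun g => force φ (q g) (x g .: e))).
    { intros k q x Hq Hx. apply (force_definable HV P φ k q (fun g => x g .: e)); auto. intro i; term_solve. }
    apply (small_all HV (le P p) (fun q => forall x, in_app x (e a) q -> force φ q (x .: e))).
    + apply is_set_up; auto.
    + intros k q Hq. 
      apply (definable_all (fun g x => in_app x (e a) (q g) -> force φ (q g) (x .: e))).
      apply definable_imp; [prove_definable|]. 
      apply (HF (S k) (fun g => q (tail g)) (fun g => g None)); term_solve.
    + intros q Hq. assert (Kq : denotes q (e a)) by (eapply denotes_le; eauto).
      apply (small_all HV (fun x => in_app x (e a) q)).
      * apply (denotes_is_set HV P); auto.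
      * intros k x Hx. apply (HF k (fun _ => q)); auto using term_const.
      * intros x Hx. apply IHDelta0; [eapply le_node_r; eauto|].
        apply denotes_env_cons; eauto using denotes_env_le. apply D_denotes, (denotes_elem HV P q (e a)); auto.
  - eapply small_iff; [apply (force_BEx HV); auto|].
    apply (small_ex HV (fun x => in_app x (e a) p)).
    + apply (denotes_is_set HV P); auto.
    + intros k x Hx. apply (force_definable HV P φ k (fun _ => p) (fun g => x g .: e)); auto using term_const.
      intro i; term_solve.
    + intros x Hx. apply IHDelta0; auto. apply denotes_env_cons; auto.
      apply D_denotes, (denotes_elem HV P p (e a)); auto.
Qed.

(** Separate the singleton of [a] by the constant predicate [Q]. *)
Lemma small_of_Sep (HSep : satisfies V Sep) (Q : Prop) :
  definable1 (fun _ : V => Q) -> small Q.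
Proof.
  intros HQ a. destruct (definable1_formula _ HQ) as (n & φ & e & H).
  destruct (is_set_sing HV a) as [s Hs].
  destruct (sat_closure _ (HSep _ (Sep_intro φ)) e s) as [t Ht].
  exists t; intros z. specialize (Ht z); simpl in Ht. rewrite sat_ren in Ht.
  rewrite (sat_ext φ _ (z .: e)) in Ht; [|intros [i|]; reflexivity].
  specialize (Hs z); specialize (H z). unfold iff in *; tauto.
Qed.

Lemma small_force_Sep (HSep : satisfies V Sep) {n} (φ : formula n) p e : small (force φ p e).
Proof.
  apply small_of_Sep; auto. intros k x Hx.
  apply (force_definable HV P φ k (fun _ => p) (fun _ => e)); auto using term_const.
Qed.

End Comprehension.

(** * Collection, subset collection and power set *)

Section Collection.

Context {V : structure} (HV : satisfies V CZFminus) (P : frame V).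

Local Notation is_set := (@is_set V).
Local Notation D := (kripke_set P).
Local Notation denotes := (denotes P).
Local Notation denotes_env := (denotes_env P).
Local Notation mem_at := (mem_at P).
Local Notation eq_at := (eq_at P).
Local Notation force := (force P).

Lemma is_set_graph_from p a : denotes p a ->
  is_set (fun c => exists r x, le P p r /\ in_app x a r /\ is_opair r x c).
Proof.
  intros Ha. apply (is_set_sigma HV (le P p) (fun r x => in_app x a r)).
  - apply is_set_up; auto.
  - prove_definable.
  - intros r Hr. apply (denotes_is_set HV P). eapply denotes_le; eauto.
Qed.

(** Collect, for the pairs [(r, x)] with [x] in [a(r)], pairs [(r, y)] with [y] a
    witness for [x] at [r].  The name generated by them gains only restrictions
    [z] of witnesses [z0] from lower nodes, and those are witnesses for the
    restriction of [x] because forcing is monotone. *)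
Lemma valid_StrongCollection {n} (φ : formula (S (S n))) : valid P (StrongCollection φ).
Proof.
  intros p e Hp He q1 H1 a Ha q Hq H.
  assert (Ka : forall r, le P q r -> denotes r a)
    by (intros; eapply denotes_le; [|eauto]; eapply denotes_le; [apply D_denotes; eauto|auto]).
  assert (Hpq : forall r, le P q r -> le P p r)
    by (intros; eapply le_trans; [|eauto]; eapply le_trans; eauto).
  assert (HKe : forall r, le P q r -> denotes_env r e)
    by (intros r Hr; apply (denotes_env_le P p r); auto).
  assert (Hqq : le P q q) by (apply le_refl; eapply le_node_r; eauto).
  pose (Φ r y x := force φ r (y .: x .: e)).
  assert (HΦ : definable3 Φ).
  { intros k r y x Hr Hy Hx. apply (force_definable HV P φ k r (fun g => y g .: x g .: e)); auto.
    intro i; term_solve. }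
  assert (HC : forall r, le P q r -> forall x, in_app x a r ->
    exists y, D r y /\ Φ r y x).
  { intros r Hr x Hx. rewrite (force_BAll HV) in H.
    - destruct (H r Hr x Hx) as (y & Hy & Hf). exists y; split; auto.
      revert Hf. apply force_ren. intros [[i|]|]; reflexivity.
    - apply denotes_env_cons; [auto|]. auto. }
  clear H.
  destruct (collection HV _ (fun c d => exists r x y, is_opair r x c /\ in_app x a r /\
    D r y /\ Φ r y x /\ is_opair r y d) (is_set_graph_from q a (Ka q Hqq)))
    as (B & HB1 & HB2).
  - pose proof (kripke_set_definable HV P). prove_definable.
  - intros c (r & x & Hr & Hx & Hc). destruct (HC r Hr x Hx) as (y & Hy & Hf).
    destruct (opair_ex HV r y) as [d Hd]. exists d, r, x, y; auto.
  - assert (HBD : forall r y, pair_in r y B -> D r y /\ exists x, in_app x a r /\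
      Φ r y x).
    { intros r y (d & Hd & Hi). destruct (HB2 d Hi) as (c & _ & r' & x & y' & _ & Hx & Hy & Hf & Hd').
      destruct (opair_inj HV _ _ _ _ _ Hd Hd'); subst r' y'. eauto. }
    destruct (D_generated HV P q (fun r y => pair_in r y B)) as (b & Hb & Hbz).
    + eapply le_node_r; eauto.
    + prove_definable.
    + intros; apply is_set_section; auto.
    + intros r y _ Hy. apply HBD; auto.
    + assert (Kb : denotes q b) by (apply D_denotes; auto).
      exists b; split; auto. split; apply (force_BAll HV);
        try (repeat apply denotes_env_cons; auto; fail).
      * intros r Hr x Hx.
        destruct (opair_ex HV r x) as [c Hc].
        destruct (HB1 c) as (d & Hd & r' & x' & y & Hc' & _ & Hy & Hf & Hd'); [eauto 6|].
        destruct (opair_inj HV _ _ _ _ _ Hc Hc'); subst r' x'.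
        assert (Kx : denotes r x) by (apply D_denotes, (denotes_elem HV P r a); auto).
        apply (force_BEx HV).
        { repeat apply denotes_env_cons; auto. eapply denotes_le; eauto. }
        exists y; split.
        -- apply Hbz; auto. exists r, y. split; [auto|split; [|split]].
           ++ apply le_refl; eapply le_node_r; eauto.
           ++ exists d; auto.
           ++ apply D_restr_id; auto.
        -- revert Hf. apply force_ren. intros [[i|]|]; reflexivity.
      * intros r Hr z Hz. apply Hbz in Hz; auto.
        destruct Hz as (t & z0 & Ht & Htr & Hz0 & Hzr).
        destruct (HBD _ _ Hz0) as (HD0 & x & Hx & Hf).
        assert (Kz0 : denotes r z0) by (eapply denotes_le; [apply D_denotes; eauto|auto]).
        assert (Kz : denotes r z) by (apply D_denotes, (denotes_restr HV P r z0); auto).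
        assert (Kx : denotes t x) by (apply D_denotes, (denotes_elem HV P t a); auto).
        assert (Kx' : denotes r x) by (eapply denotes_le; eauto).
        destruct (denotes_restr_ex HV P r x Kx') as (x' & Hx' & HDx').
        apply (force_BEx HV).
        { repeat apply denotes_env_cons; auto. eapply denotes_le; eauto. }
        exists x'; split.
        -- apply (denotes_mono HV P t a r x x'); auto.
        -- apply (force_ren P φ _ _ _ _ (z .: x' .: e)); [intros [[i|]|]; reflexivity|].
           apply (force_eq_at HV P φ r (z0 .: x .: e)).
           ++ eapply le_node_r; eauto.
           ++ repeat apply denotes_env_cons; auto.
           ++ repeat apply denotes_env_cons; auto. apply D_denotes; auto.
           ++ intros [[i|]|]; simpl.
              ** apply eq_at_refl; auto. apply HKe; auto.
              ** apply eq_at_restr; auto.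
              ** apply eq_at_restr; auto.
           ++ apply (force_mono HV P φ t r); auto. repeat apply denotes_env_cons; auto using D_denotes.
Qed.

Lemma V_subset_collection (HS : satisfies V SubColl) (R : V -> V -> V -> Prop) (a b : V) :
  definable3 R -> exists c : V, forall u,
    (forall x, x ∈ a -> exists y, y ∈ b /\ R y x u) ->
    exists d, d ∈ c /\ (forall x, x ∈ a -> exists y, y ∈ d /\ R y x u) /\
      (forall y, y ∈ d -> exists x, x ∈ a /\ R y x u).
Proof.
  intros HR. destruct (definable3_formula _ HR) as (n & φ & e & H).
  destruct (sat_closure _ (HS _ (SubColl_intro φ)) e a b) as [c Hc].
  exists c; intros u Hu. destruct (Hc u) as (d & Hd & Hd1 & Hd2).
  - simpl. intros x Hx. destruct (Hu x Hx) as (y & Hy & Hr). exists y; split; auto.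
    rewrite sat_ren. apply H in Hr. eapply sat_ext; [|exact Hr].
    intros [[[i|]|]|]; reflexivity.
  - simpl in Hd, Hd1, Hd2. exists d; split; [auto|split].
    + intros x Hx. destruct (Hd1 x Hx) as (y & Hy & Hs). exists y; split; auto.
      rewrite sat_ren in Hs. apply H. eapply sat_ext; [|exact Hs].
      intros [[[i|]|]|]; reflexivity.
    + intros y Hy. destruct (Hd2 y Hy) as (x & Hx & Hs). exists x; split; auto.
      rewrite sat_ren in Hs. apply H. eapply sat_ext; [|exact Hs].
      intros [[[i|]|]|]; reflexivity.
Qed.

(** At a node [q] the parameter [u] concerns only the part of [a] and [b] above [q].
    Subset Collection of [V], applied to the pairs above [q], gives a set [c] that
    is full for [q]; Strong Collection gathers such [c] for all [q], and the
    members [d] of each [c] are turned into names at [q].  The parameter of the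
    scheme in [V] is just [u], as the node is recorded in the pairs. *)
Lemma valid_SubsetCollection (HS : satisfies V SubColl) {n} (φ : formula (S (S (S n)))) :
  valid P (SubsetCollection φ).
Proof.
  intros p0 e Hp He q1 H1 a Ha p H2 b Hb.
  assert (Hpp : le P p p) by (apply le_refl; eapply le_node_r; eauto).
  assert (Ka : forall r, le P p r -> denotes r a)
    by (intros; eapply denotes_le; [|eauto]; eapply denotes_le; [apply D_denotes; eauto|auto]).
  assert (Kb : forall r, le P p r -> denotes r b)
    by (intros; eapply denotes_le; [|eauto]; apply D_denotes; auto).
  assert (HKe : forall r, le P p r -> denotes_env r e).
  { intros r Hr; apply (denotes_env_le P p0 r); auto.
    eapply le_trans; [|eauto]; eapply le_trans; eauto. }
  pose (Φ r y x u := in_app y b r /\ force φ r (y .: x .: u .: e)).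
  assert (HΦ : definable4 Φ).
  { intros k r y x u Hr Hy Hx Hu. apply definable_and; [prove_definable|].
    apply (force_definable HV P φ k r (fun g => y g .: x g .: u g .: e)); auto.
    intro i; term_solve. }
  (* [c] contains, for each [u] such that all members of [a] above [q] have witnesses
     in [b], a set of pairs that supplies these witnesses and whose pairs above [q]
     are all witnesses. *)
  pose (full q c := forall u,
    (forall r x, le P q r -> in_app x a r -> exists y, Φ r y x u) ->
    exists d, d ∈ c /\
      (forall r x, le P q r -> in_app x a r -> exists y, pair_in r y d /\ Φ r y x u) /\
      (forall r y, pair_in r y d -> le P q r -> exists x, in_app x a r /\ Φ r y x u)).
  assert (Hfull : definable2 full).
  { unfold full; prove_definable. }
  assert (Hex : forall q, le P p q -> exists c, full q c).
  { intros q Hq.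
    destruct (is_set_graph_from q a (Ka q Hq)) as [A HA].
    destruct (is_set_graph_from q b (Kb q Hq)) as [B HB].
    destruct (V_subset_collection HS (fun Y X u => exists r x y, is_opair r x X /\
      is_opair r y Y /\ Φ r y x u) A B) as [c Hc].
    { prove_definable. }
    exists c; intros u Hu. destruct (Hc u) as (d & Hd & Hd1 & Hd2).
    - intros X HX. apply HA in HX. destruct HX as (r & x & Hr & Hx & HX).
      destruct (Hu r x Hr Hx) as (y & Hy & Hf).
      destruct (opair_ex HV r y) as [Y HY]. exists Y; split.
      + apply HB. exists r, y; auto.
      + exists r, x, y. split; [auto|split; [auto|split; auto]].
    - exists d; split; [auto|split].
      + intros r x Hr Hx. destruct (opair_ex HV r x) as [X HX].
        destruct (Hd1 X) as (Y & HY & r' & x' & y & HX' & HY' & Hf).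
        { apply HA. exists r, x; auto. }
        destruct (opair_inj HV _ _ _ _ _ HX HX'); subst r' x'.
        exists y; split; auto. exists Y; auto.
      + intros r y (Y & HY & Hi) Hr.
        destruct (Hd2 Y Hi) as (X & HX & r' & x & y' & HX' & HY' & Hf).
        destruct (opair_inj HV _ _ _ _ _ HY HY'); subst r' y'.
        apply HA in HX. destruct HX as (r' & x' & _ & Hx & HX).
        destruct (opair_inj HV _ _ _ _ _ HX HX'); subst r' x'.
        exists x; split; auto. }
  destruct (collection HV (le P p) (fun q h => exists c, full q c /\ is_opair q c h)
    (is_set_up HV P p)) as (C & HC1 & HC2).
  { prove_definable. }
  { intros q Hq. destruct (Hex q Hq) as [c Hc]. destruct (opair_ex HV q c) as [h Hh].
    exists h, c; auto. }
  destruct (D_generated HV P p (fun r z => exists d,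
    (exists c, pair_in r c C /\ d ∈ c) /\ name_of_pairs P b r d z)) as (cc & Hcc & Hcz).
  - eapply le_node_r; eauto.
  - pose proof (name_of_pairs_definable HV P). prove_definable.
  - intros r Hr. apply is_set_names_of_pairs; auto.
    apply is_set_iUnion; auto.
    + apply is_set_section; auto.
    + prove_definable.
    + intros c _. apply is_set_mem.
  - intros r z _ (d & _ & H & _); auto.
  - exists cc; split; auto. intros q3 H3 u Hu q Hq H.
    assert (Hpq : forall r, le P q r -> le P p r)
      by (intros; eapply le_trans; [|eauto]; eapply le_trans; eauto).
    assert (Hqq : le P q q) by (apply le_refl; eapply le_node_r; eauto).
    assert (Ku : forall r, le P q r -> denotes r u)
      by (intros; eapply denotes_le; [|eauto]; eapply denotes_le; [apply D_denotes; eauto|auto]).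
    assert (Kcc : forall r, le P q r -> denotes r cc)
      by (intros; apply (denotes_le P p); [apply D_denotes; auto|auto]).
    destruct (HC1 q (Hpq q Hqq)) as (h & Hh & c & Hc & Ho).
    destruct (Hc u) as (d & Hd & Hd1 & Hd2).
    { intros r x Hr Hx. rewrite (force_BAll HV) in H; [|repeat apply denotes_env_cons; auto].
      assert (Kx : denotes r x) by (apply D_denotes, (denotes_elem HV P r a); auto).
      specialize (H r Hr x Hx). rewrite (force_BEx HV) in H; [|repeat apply denotes_env_cons; auto].
      destruct H as (y & Hy & Hf). exists y; split; auto.
      revert Hf. apply force_ren. intros [[[i|]|]|]; reflexivity. }
    destruct (name_of_pairs_ex HV P b q d) as (z & Hz); auto.
    pose proof Hz as [HDz Hzz].
    apply (force_BEx HV); [repeat apply denotes_env_cons; auto|].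
    exists z; split.
    { apply Hcz; auto. exists q, z. split; [auto|split; [auto|split]].
      - exists d; split; auto. exists c; split; auto. exists h; auto.
      - apply D_restr_id; auto. }
    assert (Kz : forall r, le P q r -> denotes r z)
      by (intros; eapply denotes_le; [apply D_denotes; eauto|auto]).
    split; (apply (force_BAll HV); [repeat apply denotes_env_cons; auto|]).
    + intros r Hr x Hx. simpl in Hx.
      assert (Kx : denotes r x) by (apply D_denotes, (denotes_elem HV P r a); auto).
      apply (force_BEx HV); [repeat apply denotes_env_cons; auto|].
      destruct (Hd1 r x Hr Hx) as (y & Hy & Hyb & Hf).
      exists y; split.
      * apply Hzz; auto. exists r, y. split; [auto|split; [|split; [auto|]]].
        -- apply le_refl; eapply le_node_r; eauto.
        -- apply D_restr_id; auto. apply (denotes_elem HV P r b); auto.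
      * revert Hf. apply force_ren. intros [[[i|]|]|]; reflexivity.
    + intros r Hr w Hw. simpl in Hw.
      apply Hzz in Hw; auto. destruct Hw as (t & w0 & Ht & Htr & [Hw0 Hwb] & Hwr).
      destruct (Hd2 t w0 Hw0 Ht) as (x & Hx & _ & Hf).
      assert (Kw0 : denotes t w0) by (apply D_denotes, (denotes_elem HV P t b); auto).
      assert (Kw0' : denotes r w0) by (eapply denotes_le; eauto).
      assert (Kw : denotes r w) by (apply D_denotes, (denotes_restr HV P r w0); auto).
      assert (Kx : denotes t x) by (apply D_denotes, (denotes_elem HV P t a); auto).
      assert (Kx' : denotes r x) by (eapply denotes_le; eauto).
      destruct (denotes_restr_ex HV P r x Kx') as (x' & Hx' & HDx').
      apply (force_BEx HV); [repeat apply denotes_env_cons; auto|].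
      exists x'; split.
      * apply (denotes_mono HV P t a r x x'); auto.
      * apply (force_ren P φ _ _ _ _ (w .: x' .: u .: e)); [intros [[[i|]|]|]; reflexivity|].
        apply (force_eq_at HV P φ r (w0 .: x .: u .: e)).
        -- eapply le_node_r; eauto.
        -- repeat apply denotes_env_cons; auto.
        -- repeat apply denotes_env_cons; auto. apply D_denotes; auto.
        -- intros [[[i|]|]|]; simpl; try (apply eq_at_restr; auto; fail); apply eq_at_refl; auto.
           apply HKe; auto.
        -- apply (force_mono HV P φ t r); auto. repeat apply denotes_env_cons; auto.
Qed.

(** A subname [y] of [a] at [q] is determined by its graph, a subset of the set of
    pairs [(r, z)] with [z] in [a(r)].  Since every subset of that set generates a
    subname, the subnames are the image of a power set of [V], with no need to
    separate the monotone subsets. *)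
Lemma valid_PowerSet (HP : satisfies V Pow) : valid P PowerSet.
Proof.
  intros p0 e Hp He p H1 a Ha.
  assert (Hpp : le P p p) by (apply le_refl; eapply le_node_r; eauto).
  assert (Ka : forall r, le P p r -> denotes r a)
    by (intros; eapply denotes_le; [|eauto]; apply D_denotes; auto).
  pose (N q y := D q y /\ forall r, le P q r -> forall z, in_app z y r -> in_app z a r).
  destruct (D_comprehension HV P p N) as (b & Hb & Hbz).
  - eapply le_node_r; eauto.
  - pose proof (kripke_set_definable HV P). unfold N; prove_definable.
  - intros q Hq. destruct (is_set_graph_from q a (Ka q Hq)) as [A HA].
    destruct (HP _ Pow_intro A) as [B HB].
    apply (is_set_iff (fun y => exists d, d ∈ B /\ name_of_pairs P a q d y)).
    2: { apply is_set_names_of_pairs; auto using is_set_mem. }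
    intros y; split.
    + intros [HD Hy].
      destruct (is_set_graph HV P q y (D_fun HV P _ _ HD)) as [d Hd].
      exists d; split.
      * apply HB. simpl. intros c Hc. apply HA. apply Hd in Hc.
        destruct Hc as (r & z & Hr & Hz & Hc). exists r, z; auto.
      * split; auto. intros r Hr z. split.
        -- intros Hz. exists r, z. split; [auto|split; [|split; [split|]]].
           ++ apply le_refl; eapply le_node_r; eauto.
           ++ destruct (opair_ex HV r z) as [c Hc]. exists c; split; auto.
              apply Hd. exists r, z; auto.
           ++ auto.
           ++ apply D_restr_id; auto. eapply D_elem; eauto.
        -- intros (t & z0 & Ht & Htr & [(c & Hc & Hi) _] & Hz).
           apply Hd in Hi. destruct Hi as (t' & z' & _ & Hz' & Hc').
           destruct (opair_inj HV _ _ _ _ _ Hc Hc'); subst t' z'.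
           eapply D_mono; eauto.
    + intros (d & _ & HD & Hy). split; auto.
      intros r Hr z Hz. apply Hy in Hz; auto.
      destruct Hz as (t & z0 & Ht & Htr & [_ Hz0] & Hz).
      apply (denotes_mono HV P t a r z0 z); auto. apply Ka. eapply le_trans; eauto.
  - intros q y _ [H _]; auto.
  - intros q r y y' Hq Hr [HD Hy] Hy'. split.
    + eapply D_restr; eauto.
    + intros t Ht z Hz. apply Hy; [eapply le_trans; eauto|].
      apply (restr_app HV _ _ _ _ Hy'); auto.
  - exists b; split; auto. intros q2 H2 x Hx.
    assert (L : forall q, le P q2 q -> (mem_at q x b <->
      force (BAll v0 (Mem v0 v3)) q (x .: b .: a .: e))).
    { intros q Hq. assert (Hq' : le P p q) by (eapply le_trans; eauto).
      assert (Kx : denotes q x) by (eapply denotes_le; [apply D_denotes; eauto|auto]).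
      destruct (denotes_restr_ex HV P _ _ Kx) as (x' & Hx' & HDx').
      rewrite (mem_at_restr HV P q x x'), (Hbz q Hq'); auto.
      rewrite (force_BAll HV).
      - assert (HD : forall r, le P q r -> forall z, in_app z x r -> D r z).
        { intros r Hr z Hz. apply (denotes_elem HV P r x); auto. eapply denotes_le; eauto. }
        split.
        + intros [_ H] r Hr z Hz. apply (mem_at_D HV P r z a); eauto.
          apply H; auto. apply (restr_app HV _ _ _ _ Hx'); auto.
        + intros H; split; auto. intros r Hr z Hz.
          apply (restr_app HV _ _ _ _ Hx') in Hz; auto.
          apply (mem_at_D HV P r z a); eauto. apply (H r Hr z Hz).
      - repeat apply denotes_env_cons; auto.
        + eapply denotes_le; [apply D_denotes; eauto|auto].
        + apply (denotes_env_le P p0); auto. eapply le_trans; eauto. }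
    split; intros q Hq; apply L; auto.
Qed.

(** * Infinity *)

Definition name_zero (y : V) : Prop :=
  D (bot P) y /\ forall q, le P (bot P) q -> forall w, ~ in_app w y q.

(** The name of [z ∪ {z}] at the least node. *)
Definition name_succ (z y : V) : Prop :=
  D (bot P) y /\ forall q, le P (bot P) q -> forall w,
    in_app w y q <-> in_app w z q \/ restr P z q w.

(** [y] names zero, or the successor of a numeral of some member of [n].  For [n] a
    von Neumann numeral these are all the numerals up to [n]; allowing smaller
    ones makes the step uniform in [n], with no case distinction on [n]. *)
Definition numeral_step (H : V -> V -> V -> Prop) (n p y : V) : Prop :=
  name_zero y \/ exists m z, m ∈ n /\ H m p z /\ D (bot P) z /\ name_succ z y.

(** The middle place of the triples holds the node at which the numerals are named,
    constantly the least one. *)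
Definition numeral (n y : V) : Prop := gfp numeral_step n (bot P) y.

Lemma numeral_step_definable k (G a b c : (var k -> V) -> V) : term G -> term a -> term b -> term c ->
  definable (fun g => numeral_step (otriple_in (G g)) (a g) (b g) (c g)).
Proof.
  intros. pose proof (kripke_set_definable HV P).
  unfold numeral_step, name_zero, name_succ. prove_definable.
Qed.

Lemma numeral_unfold n y : numeral n y <->
  name_zero y \/ exists m z, m ∈ n /\ numeral m z /\ D (bot P) z /\ name_succ z y.
Proof.
  assert (Hm : forall H H' : V -> V -> V -> Prop,
    (forall a b c, H a b c -> H' a b c) ->
    forall a b c, numeral_step H a b c -> numeral_step H' a b c).
  { intros H H' I a b c [h|(m & z & h1 & h2 & h3)]; [left; auto|right; eauto 6]. }
  split.
  - intros H. exact (gfp_unfold _ Hm _ _ _ H).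
  - intros H. apply (gfp_fold HV numeral_step); auto.
    + apply numeral_step_definable.
    + clear n y H. intros H HH n p y [h|(m & z & h1 & h2 & h3)].
      * destruct (is_set_empty HV) as [G HG]. exists G; split.
        -- intros d Hd; destruct (proj1 (HG d) Hd).
        -- left; auto.
      * destruct (is_otriple_ex HV m p z) as [c Hc]. destruct (is_set_sing HV c) as [G HG].
        exists G; split.
        -- intros d Hd. apply HG in Hd; subst d. eauto.
        -- right. exists m, z; split; [auto|split; auto].
           exists c; split; auto. apply HG; auto.
Qed.

Lemma numeral_definable : definable2 numeral.
Proof.
  intros k a b Ha Hb. apply (gfp_definable _ numeral_step_definable); auto using term_const.
Qed.

Lemma numeral_kripke_set n y : numeral n y -> D (bot P) y.
Proof.
  intros H. apply numeral_unfold in H. destruct H as [[H _]|(_ & _ & _ & _ & _ & H & _)]; auto.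
Qed.

Lemma bot_up q : q ∈ nodes P -> le P (bot P) q.
Proof. apply bot_least. Qed.

Lemma name_zero_ex : exists y, name_zero y.
Proof.
  destruct (D_comprehension HV P (bot P) (fun _ _ => False)) as (y & Hy & H).
  - apply bot_node.
  - prove_definable.
  - intros; apply is_set_empty; auto.
  - tauto.
  - tauto.
  - exists y; split; auto. intros q Hq w Hw. apply (H q Hq w), Hw.
Qed.

Lemma name_succ_ex z : D (bot P) z -> exists y, name_succ z y.
Proof.
  intros Hz.
  assert (Kz : forall q, le P (bot P) q -> denotes q z)
    by (intros; eapply denotes_le; [apply D_denotes; eauto|auto]).
  apply D_comprehension; auto.
  - apply bot_node.
  - prove_definable.
  - intros q Hq. apply (is_set_or HV); [apply (denotes_is_set HV P)|apply is_set_restr]; auto.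
  - intros q y Hq [H|H]; [apply (denotes_elem HV P q z)|apply (denotes_restr HV P q z)]; auto.
  - intros q r y y' Hq Hr [H|H] Hy; [left|right].
    + apply (denotes_mono HV P q z r y y'); auto.
    + exact (proj1 (restr_restr P _ _ _ _ _ Hr H) Hy).
Qed.

(** Taking successors is functional, so ∈-induction and Replacement apply. *)
Lemma is_set_numeral n : is_set (numeral n).
Proof.
  pose proof numeral_definable as ND. pose proof (kripke_set_definable HV P) as DD.
  revert n. apply (V_ind HV); [unfold is_set; prove_definable|]. intros n IH.
  eapply is_set_iff; [intros; apply numeral_unfold|]. apply (is_set_or HV).
  - destruct name_zero_ex as [y Hy]. apply (is_set_iff (fun z => z = y)).
    + intros z; split; [|intros ->; auto]. intros Hz. destruct Hz as [H1 H2], Hy as [H3 H4].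
      apply (D_ext HV P (bot P)); auto. intros q Hq w. split; intros h.
      * destruct (H2 q Hq w h).
      * destruct (H4 q Hq w h).
    + apply is_set_sing; auto.
  - apply (is_set_iff (fun y => exists m, m ∈ n /\ exists z, numeral m z /\ D (bot P) z /\ name_succ z y)).
    { intros y; split.
      - intros (m & z & h1 & h2); eauto.
      - intros (m & h1 & z & h2); eauto. }
    apply (is_set_iUnion HV (fun m => m ∈ n)).
    + apply is_set_mem.
    + unfold name_succ; prove_definable.
    + intros m Hm. apply (is_set_repl HV (numeral m)); auto.
      * unfold name_succ; prove_definable.
      * intros z Hz. assert (HD : D (bot P) z) by (eapply numeral_kripke_set; eauto).
        destruct (name_succ_ex z HD) as [y Hy]. exists y; split; auto.
        intros y' [_ Hy']. destruct Hy as [H1 H2], Hy' as [H3 H4].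
        apply (D_ext HV P (bot P)); auto. intros q Hq w. rewrite H2, H4; auto. tauto.
Qed.

(** The name collects the numerals of the members of an infinite set [X] of [V].  If
    [y] is a numeral of [n] in [X], then its successor is a numeral of
    [n ∪ {n}], which is in [X] too. *)
Lemma valid_Infinity : valid P Infinity.
Proof.
  intros p e Hp He. pose proof numeral_definable as ND.
  destruct (HV _ CZF_inf) as (X & (n0 & Hn0 & _) & HX).
  simpl in Hn0, HX.
  assert (HW : is_set (fun y => exists n, n ∈ X /\ numeral n y)).
  { apply (is_set_iUnion HV); [apply is_set_mem | prove_definable | intros; apply is_set_numeral]. }
  assert (KW : forall n y q, numeral n y -> q ∈ nodes P -> denotes q y).
  { intros n y q Hy Hq. apply (denotes_le P (bot P)); [|apply bot_up; auto].
    apply (D_denotes HV P). eapply numeral_kripke_set; eauto. }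
  destruct (D_comprehension HV P p (fun q z => exists y, (exists n, n ∈ X /\ numeral n y) /\
    restr P y q z)) as (x & Hx & Hxz); auto.
  - prove_definable.
  - intros q Hq. apply (is_set_iUnion HV); auto; [prove_definable|].
    intros y (n & Hn & Hy). apply is_set_restr; auto. eapply KW; eauto. eapply le_node_r; eauto.
  - intros q z Hq (y & (n & Hn & Hy) & Hz). apply (denotes_restr HV P q y); auto.
    eapply KW; eauto. eapply le_node_r; eauto.
  - intros q r z z' Hq Hr (y & Hy & Hz) Hz'. exists y; split; auto.
    exact (proj1 (restr_restr P _ _ _ _ _ Hr Hz) Hz').
  - exists x; split; auto.
    assert (Kx : forall q, le P p q -> denotes q x) by (intros; eapply denotes_le; [apply D_denotes; eauto|auto]).
    assert (Hpp : le P p p) by (apply le_refl; auto).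
    split.
    + apply (force_BEx HV); [apply denotes_env_cons; auto|].
      destruct name_zero_ex as [z Hz].
      assert (Hn : numeral n0 z) by (apply numeral_unfold; auto).
      destruct (denotes_restr_ex HV P p z) as (z' & Hz' & HDz'); [eauto|].
      exists z'; split.
      * apply Hxz; eauto.
      * apply (force_BAll HV); [repeat apply denotes_env_cons; auto using D_denotes|].
        intros q Hq w Hw. simpl in Hw. apply (restr_app HV _ _ _ _ Hz') in Hw; auto.
        destruct Hz as [_ Hz]. apply (Hz q) in Hw; auto. apply bot_up. eapply le_node_r; eauto.
    + apply (force_BAll HV); [repeat apply denotes_env_cons; auto|].
      intros q Hq y Hy. simpl in Hy. apply Hxz in Hy; auto.
      destruct Hy as (y0 & (n & Hn & Hy0) & Hy).
      assert (Hqn : q ∈ nodes P) by (eapply le_node_r; eauto).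
      assert (Ky0 : denotes q y0) by eauto.
      assert (Ky : denotes q y) by (apply D_denotes, (denotes_restr HV P q y0); auto).
      destruct (HX n Hn) as (s & Hs & Hsn).
      destruct (name_succ_ex y0) as [y1 Hy1]; [eapply numeral_kripke_set; eauto|].
      assert (Hy1n : numeral s y1).
      { apply numeral_unfold. right. exists n, y0. split; [apply Hsn; auto|].
        split; [auto|split; [eapply numeral_kripke_set; eauto|auto]]. }
      destruct (denotes_restr_ex HV P q y1) as (s1 & Hs1 & HDs1); [eauto|].
      apply (force_BEx HV); [repeat apply denotes_env_cons; auto; apply (denotes_env_le P p); auto|].
      exists s1; split; [apply Hxz; eauto|].
      intros q2 Hq2 z Hz.
      assert (L : forall r, le P q2 r -> (mem_at r z s1 <-> mem_at r z y \/ eq_at r z y)).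
      { intros r Hr. assert (Hqr : le P q r) by (eapply le_trans; eauto).
        assert (Hrn : r ∈ nodes P) by (eapply le_node_r; eauto).
        assert (Kz : denotes r z) by (eapply denotes_le; [apply D_denotes; eauto|auto]).
        assert (Kyr : denotes r y) by (eapply denotes_le; eauto).
        destruct (denotes_restr_ex HV P _ _ Kz) as (z' & Hz' & _).
        rewrite (mem_at_restr HV P r z z' s1), (mem_at_restr HV P r z z' y),
          (eq_at_restr_iff HV P r z z' y); auto.
        rewrite (restr_app HV _ _ _ _ Hs1 r Hqr), (restr_app HV _ _ _ _ Hy r Hqr).
        rewrite (restr_restr P _ _ _ _ z' Hqr Hy).
        apply Hy1. apply bot_up; auto. }
      split; intros r Hr; apply L; auto.
Qed.

End Collection.

Theorem theorem4p10 (V : structure) (HV : satisfies V CZFminus) (P : frame V) :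
  kripke_satisfies P CZFminus /\
  (satisfies V SubColl -> kripke_satisfies P SubColl) /\
  (satisfies V Sep -> kripke_satisfies P Sep) /\
  (satisfies V Pow -> kripke_satisfies P Pow).
Proof.
  split; [|split; [|split]].
  - intros φ [ | | | | n ψ | n ψ H | n ψ]; apply (valid_forces HV P).
    + apply valid_Extensionality; auto.
    + apply valid_Pairing; auto.
    + apply valid_Union; auto.
    + apply valid_Infinity; auto.
    + apply (valid_closure HV), valid_Induction; auto.
    + apply (valid_closure HV), valid_Separation; auto.
      intros; apply small_force_Delta0; auto.
    + apply (valid_closure HV), valid_StrongCollection; auto.
  - intros HS φ [n ψ]. apply (valid_forces HV P), (valid_closure HV).
    apply valid_SubsetCollection; auto.
  - intros HS φ [n ψ]. apply (valid_forces HV P), (valid_closure HV).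
    apply valid_Separation; auto. intros; apply small_force_Sep; auto.
  - intros HP φ []. apply (valid_forces HV P), valid_PowerSet; auto.
Qed.
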